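(* Let $\widetilde{W}/W\in\{\widetilde{C}_n/C_n,\widetilde{B}_n/B_n,\widetilde{B}_n/D_n,\widetilde{D}_n/D_n\}$ and let $\lambda=(\lambda_1,\dots,\lambda_k)$ be a symmetric $(2n)$-core partition with $\lambda=\mathcal{C}(w)$ for $w=\mathcal{W}(\lambda)\in\widetilde{W}/W$. If all parts of $\lambda$ are less than or equal to $n$, then $$\ell(\mathcal{W}(\lambda))=\sum_{1\le i\le k}\max(0,\lambda_i-i+1+x_0).$$ Otherwise, for $1\le i\le n$ define $R(i)$ to be the (index of the topmost) longest row of $\lambda$ having runner number $i$ or $N-i$ labeling its rightmost box. Follow the boundary of $\lambda$ extended $n$ steps out in each direction from its center, a path which involves $n$ vertical steps and $n$ horizontal steps. Define $r(i)$ to be the (index of the) unique row of $\lambda$ ending with one of these $n$ vertical steps and whose rightmost box is labeled by the same choice of $i$ or $N-i$ as for $R(i)$. Define $d$ to be the number of rows of $\lambda$ whose box on the main diagonal has hook length greater than $2n$. Then $$\ell(\mathcal{W}(\lambda))=\sum_{i=1}^n\big(\lambda_{R(i)}-\lambda_{r(i)}\big)+(1+x_0+x_n)d+\sum_{d+1\le i\le k}\max(0,\lambda_i-i+1+x_0).$$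
   Context: Offsets: $x_0=0$ in types $\widetilde{C}/C,\widetilde{B}/D$ and $x_0=-1$ in types $\widetilde{B}/B,\widetilde{D}/D$; $x_n=0$ in types $\widetilde{C}/C,\widetilde{B}/B$ and $x_n=-1$ in types $\widetilde{B}/D,\widetilde{D}/D$. Groups. Let $N=2n+1$. A mirrored $\mathbb{Z}$-permutation is a bijection $w:\mathbb{Z}\to\mathbb{Z}$ with $w(i+N)=w(i)+N$ and $w(-i)=-w(i)$ for all $i\in\mathbb{Z}$; it is determined by $(w(1),\dots,w(n))$. Under composition these form the affine Coxeter group $\widetilde{C}_n$. Define elements by their images $(w(1),\dots,w(n))$: $s_i=(1,\dots,i-1,i+1,i,i+2,\dots,n)$ for $1\le i\le n-1$; $s_0^C=(-1,2,3,\dots,n)$; $s_0^D=(-2,-1,3,\dots,n)$; $s_n^C=(1,\dots,n-1,n+1)$; $s_n^D=(1,\dots,n-2,n+1,n+2)$. The four types are: - $\widetilde{C}/C$: $\widetilde{W}$ is all mirrored $\mathbb{Z}$-permutations, generators $s_0=s_0^C,s_1,\dots,s_{n-1},s_n=s_n^C$ ($n\ge2$). - $\widetilde{B}/B$: those with $|\{i\le0:w(i)\ge1\}|$ even, generators $s_0=s_0^D,s_1,\dots,s_{n-1},s_n=s_n^C$ ($n\ge3$). - $\widetilde{B}/D$: those with $|\{i\le n:w(i)\ge n+1\}|$ even, generators $s_0=s_0^C,s_1,\dots,s_{n-1},s_n=s_n^D$ ($n\ge3$). - $\widetilde{D}/D$: those satisfying both parity conditions, generators $s_0=s_0^D,s_1,\dots,s_{n-1},s_n=s_n^D$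 ($n\ge4$). $W$ is generated by $s_1,\dots,s_n$, and $\widetilde{W}/W$ denotes the set of minimal length representatives of the cosets $wW$. $\ell$ is Coxeter length in $\widetilde{W}$ with respect to $s_0,\dots,s_n$. Abaci and cores. An abacus has runners (columns) $1,\dots,2n$; runner $i$ has entries labeled $mN+i$ for each level $m\in\mathbb{Z}$; some entries are beads, the others gaps; reading order is the order of labels; ''lowest'' means largest label; the abacus is flush if no bead is preceded by a gap on its runner. $\mathcal{A}(w)$ is the flush abacus whose lowest bead in each runner is an element of $\{w(1),\dots,w(2n)\}$. $\mathcal{C}(w)$ is the partition whose southeast boundary is the lattice path obtained by reading the entries of $\mathcal{A}(w)$ in reading order, recording a north-step for each bead and an east-step for each gap (first row at the top). $w\mapsto\mathcal{C}(w)$ is a bijection from $\widetilde{W}/W$ onto the symmetric $(2n)$-cores (types $\widetilde{C}/C,\widetilde{B}/D$), or the symmetric $(2n)$-cores with an even number of main-diagonal boxes (types $\widetilde{B}/B,\widetilde{D}/D$); $\mathcal{W}$ is the inverse. A symmetric $(2n)$-core is a self-conjugate partition with no hook length divisible by $2n$. The center of the boundary of $\lambda$ is the midpoint of the southeast boundary path, i.e. the southeast corner of the lowest box on the main diagonal. Runner numbers. Each box $(i,j)$ (row $i$, column $j$) is labeled by the runner number $1+((j-i)\bmod 2n)\in\{1,\dots,2n\}$; thus the label of the last box in a row is the runner of the bead of the abacus corresponding to that row. *)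

(* Defs.v *)
From mathcomp Require Import all_boot all_order all_algebra.
From mathcomp Require Import boolp.

Set Implicit Arguments.
Unset Strict Implicit.
Unset Printing Implicit Defensive.

Import Order.TTheory GRing.Theory Num.Theory.
Local Open Scope ring_scope.

(* The pairs C~/C, B~/B, B~/D, D~/D: each is determined by whether the left end
   s_0 and the right end s_n of the Coxeter graph are of shape C or D. *)
Inductive affine_type := CC | BB | BD | DD.

Definition left_D (ty : affine_type) : bool :=
  match ty with BB | DD => true | CC | BD => false end.
Definition right_D (ty : affine_type) : bool :=
  match ty with BD | DD => true | CC | BB => false end.

Definition min_rank (ty : affine_type) : nat :=
  match ty with CC => 2 | BB | BD => 3 | DD => 4 end.

Definition offset0 (ty : affine_type) : int := if left_D ty then -1 else 0.
Definition offsetn (ty : affine_type) : int := if right_D ty then -1 else 0.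

Definition period (n : nat) : int := (2 * n + 1)%N%:Z.

Definition mirrored (n : nat) (w : int -> int) : Prop :=
  [/\ bijective w,
      forall i, w (i + period n) = w i + period n
    & forall i, w (- i) = - w i].

Definition even_count (P : pred int) : Prop :=
  exists s : seq int, [/\ uniq s, s =i P & ~~ odd (size s)].

Definition in_affine (ty : affine_type) (n : nat) (w : int -> int) : Prop :=
  [/\ mirrored n w,
      left_D ty -> even_count [pred i : int | (i <= 0) && (1 <= w i)]
    & right_D ty -> even_count [pred i : int | (i <= n%:Z) && (n%:Z + 1 <= w i)]].

(* The map of Z determined by the images f 1, ..., f n and the identities
   w (i + N) = w i + N, w (- i) = - w i (whence w (N - i) = N - w i). *)
Definition extend (n : nat) (f : nat -> int) (i : int) : int :=
  let r := absz (i %% period n)%Z in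
  (i %/ period n)%Z * period n +
  (if r == 0%N then 0
   else if (r <= n)%N then f r
   else period n - f (2 * n + 1 - r)%N).

Definition window_mid (i j : nat) : int :=
  if j == i then i%:Z + 1 else if j == i.+1 then i%:Z else j%:Z.
Definition window_0C (j : nat) : int := if j == 1%N then -1 else j%:Z.
Definition window_0D (j : nat) : int :=
  if j == 1%N then -2 else if j == 2%N then -1 else j%:Z.
Definition window_nC (n j : nat) : int := if j == n then n%:Z + 1 else j%:Z.
Definition window_nD (n j : nat) : int :=
  if j == n.-1 then n%:Z + 1 else if j == n then n%:Z + 2 else j%:Z.

Definition simple_refl (ty : affine_type) (n i : nat) : int -> int :=
  extend n
    (if i == 0%N then (if left_D ty then window_0D else window_0C)
     else if i == n then (if right_D ty then window_nD n else window_nC n)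
     else window_mid i).

Definition word_prod (ty : affine_type) (n : nat) (s : seq 'I_n.+1) : int -> int :=
  foldr (fun (i : 'I_n.+1) f => simple_refl ty n i \o f) id s.

Definition has_word (ty : affine_type) (n : nat) (w : int -> int) (k : nat) : bool :=
  `[< exists s : seq 'I_n.+1, size s = k /\ word_prod ty s =1 w >].

(* The value 0 in the second branch concerns only maps that are not products of
   the generators. *)
Definition coxeter_length (ty : affine_type) (n : nat) (w : int -> int) : nat :=
  if pselect (exists k, has_word ty n w k) is left e then ex_minn e else 0%N.

Definition in_parabolic (ty : affine_type) (n : nat) (v : int -> int) : Prop :=
  exists s : seq 'I_n.+1, all (fun i => i != ord0) s /\ word_prod ty s =1 v.

Definition min_coset_rep (ty : affine_type) (n : nat) (w : int -> int) : Prop :=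
  in_affine ty n w /\
  forall v, in_parabolic ty n v ->
    (coxeter_length ty n w <= coxeter_length ty n (w \o v))%N.

(* A partition is la = [:: la_1; ...; la_k]; rows and columns are indexed from 1. *)

Definition is_partition (la : seq nat) : bool := sorted geq la && (0%N \notin la).

Definition part (la : seq nat) (i : nat) : nat := nth 0%N la i.-1.
Definition conj_part (la : seq nat) (j : nat) : nat := count (leq j) la.

Definition self_conjugate (la : seq nat) : Prop :=
  forall i, (0 < i)%N -> part la i = conj_part la i.

Definition in_diagram (la : seq nat) (i j : nat) : bool :=
  [&& (0 < i)%N, (0 < j)%N & (j <= part la i)%N].

Definition hook_length (la : seq nat) (i j : nat) : nat :=
  ((part la i - j) + (conj_part la j - i) + 1)%N.

Definition is_core (p : nat) (la : seq nat) : Prop :=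
  forall i j, in_diagram la i j -> ~~ (p %| hook_length la i j)%N.

Definition symmetric_core (n : nat) (la : seq nat) : Prop :=
  [/\ is_partition la, self_conjugate la & is_core (2 * n) la].

(* Points of the southeast boundary are written (x, y), with x the number of
   columns to the left and y the number of rows above; each step of the path,
   read from southwest to northeast, raises the diagonal x - y by one, so a step
   is identified by the diagonal of its starting point.  The north-step ending
   row i goes from (la_i, i) to (la_i, i - 1); the east-step below column j goes
   from (j - 1, la'_j) to (j, la'_j).  Rows below and columns to the right of the
   diagram count, so the path is infinite in both directions.  Its center lies on
   the diagonal 0, between the steps -1 and 0. *)
Definition north_diag (la : seq nat) (i : nat) : int := (part la i)%:Z - i%:Z.
Definition east_diag (la : seq nat) (j : nat) : int := j%:Z - 1 - (conj_part la j)%:Z.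

Definition north_step (la : seq nat) (k : int) : Prop :=
  exists2 i : nat, (0 < i)%N & north_diag la i = k.
Definition east_step (la : seq nat) (k : int) : Prop :=
  exists2 j : nat, (0 < j)%N & east_diag la j = k.

(* An abacus is a : pred int, where a b means that the entry labeled b is a bead. *)

Definition label (n : nat) (m i : int) : int := m * period n + i.

Definition runner (n : nat) (i : int) : bool := (1 <= i) && (i <= (2 * n)%N%:Z).

Definition flush (n : nat) (a : pred int) : Prop :=
  forall i m m', runner n i -> m <= m' -> a (label n m' i) -> a (label n m i).

Definition lowest_bead (n : nat) (a : pred int) (i b : int) : Prop :=
  exists m, [/\ b = label n m i, a b & forall m', a (label n m' i) -> m' <= m].

(* a = A(w); the values of a at multiples of N, which label no entry, are
   irrelevant. *)
Definition abacus_of (n : nat) (w : int -> int) (a : pred int) : Prop :=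
  flush n a /\
  forall i, runner n i -> exists2 j, runner n j & lowest_bead n a i (w j).

(* The p-th entry in reading order; entry 0 is the one labeled 1. *)
Definition entry (n : nat) (p : int) : int :=
  label n (p %/ (2 * n)%N%:Z)%Z (1 + (p %% (2 * n)%N%:Z)%Z).

(* la = C(w): up to the choice c of the entry read at the center of the boundary,
   the steps recorded along the abacus are the steps of the boundary of la. *)
Definition core_of (n : nat) (w : int -> int) (la : seq nat) : Prop :=
  exists2 a : pred int, abacus_of n w a &
  exists c : int, forall k : int,
    if a (entry n (c + k)) then north_step la k else east_step la k.

Definition runner_number (n i j : nat) : int :=
  1 + ((j%:Z - i%:Z) %% (2 * n)%N%:Z)%Z.

Definition row_label (n : nat) (la : seq nat) (q : nat) : int :=
  runner_number n q (part la q).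

Definition is_row (la : seq nat) (q : nat) : bool := (1 <= q <= size la)%N.

Definition labeled_row (n : nat) (la : seq nat) (i q : nat) : Prop :=
  is_row la q /\ (row_label n la q = i%:Z \/ row_label n la q = period n - i%:Z).

(* q = R(i) *)
Definition is_long_row (n : nat) (la : seq nat) (i q : nat) : Prop :=
  labeled_row n la i q /\
  forall q', labeled_row n la i q' ->
    (part la q' <= part la q)%N /\ (part la q' = part la q -> (q <= q')%N).

(* q = r(i), given R = R(i): the n steps on either side of the center are those
   on the diagonals -n, ..., n - 1. *)
Definition is_center_row (n : nat) (la : seq nat) (R q : nat) : Prop :=
  [/\ is_row la q,
      - n%:Z <= north_diag la q < n%:Z
    & row_label n la q = row_label n la R].

Definition num_long_diag (n : nat) (la : seq nat) : nat :=
  count (fun i => in_diagram la i i && (2 * n < hook_length la i i)%N)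
        (iota 1 (size la)).

Definition diag_sum (ty : affine_type) (la : seq nat) (m : nat) : int :=
  \sum_(m <= i < (size la).+1)
     Num.max 0 ((part la i)%:Z - i%:Z + 1 + offset0 ty).

(* Main.v *)
(** The coset of [w] is recorded by the levels [a_1, ..., a_n] of the lowest beads
of its abacus on the runners [1, ..., n]; the level on runner [N - i] is [- a_i].
Left multiplication by the generators permutes these vectors as the reflections in
the walls of the fundamental alcove, so the least length in the coset is the number
of reflecting hyperplanes separating the alcove from the point [(a_1, ..., a_n)]:
a generator changes this number by at most one, and at a nonzero admissible vector
some generator lowers it.  On the other hand the steps of the boundary of the core
are the beads and gaps of the abacus, whose center of symmetry fixes the position
of entry 0.  Hence [lambda_{R(i)} - lambda_{r(i)}] counts the gaps between two beads
of one runner, and sorting these gaps by runner gives the same sum over pairs of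
coordinates as the hyperplane count. *)
Require Import Defs.
From mathcomp Require Import all_boot all_order all_algebra.
From mathcomp Require Import boolp zify ring.
Set Implicit Arguments.
Unset Strict Implicit.
Unset Printing Implicit Defensive.

Import Order.TTheory GRing.Theory Num.Theory.
Local Open Scope ring_scope.

(** Everything is done on [u], the inverse of [w]: the coset [w W] becomes [W u], left
    multiplication becomes composition on the right, and the level of a runner is a quotient of
    [u i] by [N]. No theory of inversions is needed: every word of an element bounds [dist] from
    above, and greedy descent produces a word of length [dist] up to a factor in [W]. That this
    factor lies in [W] takes a second descent, since a zero level vector only says that [u] maps 1,
    ..., 2n to itself. The constants of the formula come from comparing pairs of runners. For
    [i < j] the gaps fall short of the hyperplanes by one when [a j > 0]: a vector with entries 0
    and 1 has no gaps, though hyperplanes may separate it from the alcove. The deficit [j - 1] of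
    each positive [a j], together with the summand [1 + x_0] of [axis_walls], is the last sum of the
    theorem. The number [d] equals the sum of the [wall (a i)] and accounts for the axis hyperplanes
    that the gaps of a runner pair with itself leave over. *)

(** * Separating hyperplanes *)

(* The number of integers lying between [x] and a point of the open interval (0, 1),
   [x] excluded. *)
Definition wall (x : int) : int := Num.max (x - 1) (- x).

Definition pair_walls (x y : int) : int := wall (x - y) + wall (x + y).

(* The hyperplanes orthogonal to a coordinate axis are at the points of (1/2)Z in type
   C~/C, of Z in type B~/B, of 1/2 + Z in type B~/D, and absent in type D~/D. *)
Definition axis_walls (ty : affine_type) (x : int) : int :=
  (2 + offset0 ty + offsetn ty) * wall x + (1 + offset0 ty) * (0 < x)%R%:Z.

(* The number of reflecting hyperplanes separating the fundamental alcove
   1/2 > x_1 > ... > x_n > 0 (or its analogue with ends of shape D) from the point [a]. *)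
Fixpoint dist (ty : affine_type) (a : seq int) : int :=
  if a is x :: s then axis_walls ty x + \sum_(y <- s) pair_walls x y + dist ty s
  else 0.

Lemma pair_walls_ge0 x y : 0 <= pair_walls x y.
Proof. rewrite /pair_walls /wall; lia. Qed.

Lemma axis_walls_ge0 ty x : 0 <= axis_walls ty x.
Proof. rewrite /axis_walls /wall; case: ty => /=; rewrite /offset0 /offsetn /=; lia. Qed.

Lemma dist_ge0 ty a : 0 <= dist ty a.
Proof.
elim: a => //= x s IHs; apply: addr_ge0 => //; apply: addr_ge0.
  exact: axis_walls_ge0.
by apply: sumr_ge0 => y _; apply: pair_walls_ge0.
Qed.

Lemma dist_cat ty s t :
  dist ty (s ++ t) =
  dist ty s + dist ty t + \sum_(x <- s) \sum_(y <- t) pair_walls x y.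
Proof.
elim: s => [|x s IHs] /=; first by rewrite big_nil; lia.
by rewrite IHs big_cat big_cons /=; ring.
Qed.

Lemma dist_swap ty s t x y :
  dist ty (s ++ y :: x :: t) =
  dist ty (s ++ x :: y :: t) + wall (y - x) - wall (x - y).
Proof.
rewrite !dist_cat /=.
have -> : \sum_(z <- s) \sum_(j <- y :: x :: t) pair_walls z j =
          \sum_(z <- s) \sum_(j <- x :: y :: t) pair_walls z j.
  by apply: eq_bigr => z _; rewrite !big_cons; ring.
rewrite !big_cons.
have -> : pair_walls y x = pair_walls x y + wall (y - x) - wall (x - y).
  by rewrite /pair_walls [y + x]addrC; ring.
ring.
Qed.

Lemma dist_opp_last ty s x :
  dist ty (s ++ [:: - x]) =
  dist ty (s ++ [:: x]) + axis_walls ty (- x) - axis_walls ty x.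
Proof.
rewrite !dist_cat /=.
have -> : \sum_(z <- s) \sum_(j <- [:: - x]) pair_walls z j =
          \sum_(z <- s) \sum_(j <- [:: x]) pair_walls z j.
  by apply: eq_bigr => z _; rewrite !big_cons !big_nil /pair_walls opprK; ring.
rewrite !big_nil; ring.
Qed.

(** With [right_D] the axis term is a multiple of [wall x + [0 < x]], the absolute value of [x],
    hence even; only the hyperplanes on which [x + y] is constant are recounted. *)
Lemma dist_opp_last2 ty s x y : right_D ty ->
  dist ty (s ++ [:: - y; - x]) =
  dist ty (s ++ [:: x; y]) + wall (- (x + y)) - wall (x + y).
Proof.
move=> Dty; have axisN z : axis_walls ty (- z) = axis_walls ty z.
  by rewrite /axis_walls /wall; case: ty Dty => //= _; rewrite /offset0 /offsetn /=; lia.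
rewrite !dist_cat /= !axisN.
have -> : \sum_(z <- s) \sum_(j <- [:: - y; - x]) pair_walls z j =
          \sum_(z <- s) \sum_(j <- [:: x; y]) pair_walls z j.
  by apply: eq_bigr => z _; rewrite !big_cons !big_nil /pair_walls !opprK; ring.
rewrite !big_cons !big_nil /pair_walls.
have -> : - y - - x = x - y by lia.
have -> : - y + - x = - (x + y) by lia.
ring.
Qed.

(** [wall] is invariant under [z -> 1 - z], so the two summands trade places. *)
Lemma pair_walls_refl x y : pair_walls (1 - x) y = pair_walls x y.
Proof. rewrite /pair_walls /wall; lia. Qed.

Lemma dist_refl_head ty s x :
  dist ty ((1 - x) :: s) =
  dist ty (x :: s) + axis_walls ty (1 - x) - axis_walls ty x.
Proof.
by rewrite /= (eq_bigr _ (fun z _ => pair_walls_refl x z)); ring.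
Qed.

Lemma dist_refl_head2 ty s x y : left_D ty ->
  dist ty [:: 1 - y, 1 - x & s] =
  dist ty [:: x, y & s] + wall (2 - (x + y)) - wall (x + y).
Proof.
move=> Dty; have axisN z : axis_walls ty (1 - z) = axis_walls ty z.
  by rewrite /axis_walls /wall; case: ty Dty => //= _; rewrite /offset0 /offsetn /=; lia.
rewrite /= !big_cons !axisN.
rewrite (eq_bigr _ (fun z _ => pair_walls_refl x z)).
rewrite (eq_bigr _ (fun z _ => pair_walls_refl y z)) /pair_walls.
have -> : 1 - y - (1 - x) = x - y by lia.
have -> : 1 - y + (1 - x) = 2 - (x + y) by lia.
ring.
Qed.

(** * Periodic odd maps and the generators *)

Lemma divz_unique (d q y : int) : 0 < d -> q * d <= y < (q + 1) * d -> (y %/ d)%Z = q.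
Proof.
move=> d0 /andP[y1 y2]; have -> : y = q * d + (y - q * d) by lia.
rewrite divzMDl ?gt_eqF // divz_small ?addr0 //; rewrite mulrDl in y2; lia.
Qed.

Lemma period_gt0 n : 0 < period n.
Proof. by rewrite /period; lia. Qed.

Definition equivariant (n : nat) (u : int -> int) : Prop :=
  (forall i, u (i + period n) = u i + period n) /\ (forall i, u (- i) = - u i).

Lemma equivariant_comp n u v :
  equivariant n u -> equivariant n v -> equivariant n (u \o v).
Proof.
by move=> [u1 u2] [v1 v2]; split=> i /=; rewrite ?v1 ?u1 ?v2 ?u2.
Qed.

Lemma equivariant_shift n u (m x : int) :
  equivariant n u -> u (m * period n + x) = m * period n + u x.
Proof.
case=> uD _.
have nat_shift (k : nat) y : u (k%:Z * period n + y) = k%:Z * period n + u y.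
  elim: k => [|k IHk]; first by rewrite !mul0r !add0r.
  have -> : k.+1%:Z * period n + y = k%:Z * period n + y + period n by lia.
  by rewrite uD IHk; lia.
case: (leP 0 m) => m0; first by have -> : m = `|m|%N by lia.
have := nat_shift `|m|%N (m * period n + x).
have -> : `|m|%N%:Z = - m by lia.
by rewrite addrA mulNr addNr add0r => ->; lia.
Qed.

Lemma equivariant0 n u : equivariant n u -> u 0 = 0.
Proof.
case=> _ uN; have : u 0 = - u 0 by rewrite -uN oppr0.
by move: (u 0) => z; lia.
Qed.

Lemma residueP n x : exists m : int, x = m * period n \/
  exists2 i : nat, (1 <= i <= n)%N &
    x = m * period n + i%:Z \/ x = m * period n - i%:Z.
Proof.
have := divz_eq x (period n); have := ltz_pmod x (period_gt0 n).
have : period n != 0 by rewrite gt_eqF ?period_gt0.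
move/(modz_ge0 x); set q := (x %/ _)%Z; set r := (x %% _)%Z => r0 rN xE.
have pE : period n = 2 * n%:Z + 1 by rewrite /period; lia.
case: (r =P 0) => [r00|r0']; first by exists q; left; lia.
case: (leP r n%:Z) => rn.
  by exists q; right; exists `|r|%N; [lia | left; lia].
exists (q + 1); right; exists `|period n - r|%N; [lia | right].
by rewrite mulrDl; lia.
Qed.

Lemma equivariant_ext n u v : equivariant n u -> equivariant n v ->
  (forall i : nat, (1 <= i <= n)%N -> u i%:Z = v i%:Z) -> u =1 v.
Proof.
move=> eu ev uv x; have [m [->|[i iin [->| ->]]]] := residueP n x.
- by rewrite -[m * _]addr0 !equivariant_shift // (equivariant0 eu) (equivariant0 ev).
- by rewrite !equivariant_shift // uv.
- by rewrite !equivariant_shift // eu.2 ev.2 uv.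
Qed.

Lemma extend_small n f (i : nat) : (1 <= i <= n)%N -> extend n f i%:Z = f i.
Proof.
move=> iin; have pE : period n = 2 * n%:Z + 1 by rewrite /period; lia.
rewrite /extend divz_small ?modz_small; try lia.
by rewrite mul0r add0r absz_nat ifF ?ifT; lia.
Qed.

Lemma extend_equivariant n f : equivariant n (extend n f).
Proof.
have N0 : period n != 0 by rewrite gt_eqF ?period_gt0.
have pE : period n = 2 * n%:Z + 1 by rewrite /period; lia.
split=> i.
  have iE : ((i + period n) %/ period n)%Z = (i %/ period n)%Z + 1.
    by rewrite -[X in i + X]mul1r [i + _]addrC divzMDl // addrC.
  by rewrite /extend modzDr iE; ring.
have iE := divz_eq i (period n).
have := ltz_pmod i (period_gt0 n); have := modz_ge0 i N0.
rewrite /extend; move: (i %/ _)%Z (i %% _)%Z iE => q r iE r0 rN.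
case: (r =P 0) => [r00|r0'].
  have iE' : - i = (- q) * period n by rewrite iE r00; ring.
  by rewrite iE' mulzK // modzMl r00 /= !addr0 mulNr.
have iE' : - i = (- q - 1) * period n + (period n - r) by rewrite {1}iE; lia.
have -> : (- i %/ period n)%Z = - q - 1.
  by rewrite iE' divzMDl // divz_small ?addr0; lia.
have -> : (- i %% period n)%Z = period n - r.
  by rewrite iE' modzMDl modz_small; lia.
have -> : (`|(period n - r)%R| == 0)%N = false by lia.
have -> : (`|r| == 0)%N = false by lia.
case: (leqP `|r| n) => rn.
  rewrite ifF; last by lia.
  have -> : (2 * n + 1 - `|(period n - r)%R|)%N = `|r|%N by lia. ring.
rewrite ifT; last by lia.
have -> : (2 * n + 1 - `|r|)%N = `|(period n - r)%R|%N by lia. ring.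
Qed.

Lemma simple_refl_equivariant ty n k : equivariant n (simple_refl ty n k).
Proof. exact: extend_equivariant. Qed.

Lemma simple_refl_0C ty n : (0 < n)%N -> ~~ left_D ty ->
  simple_refl ty n 0 1%N = - 1%N%:Z /\
  forall j : nat, (1 < j <= n)%N -> simple_refl ty n 0 j%:Z = j%:Z.
Proof.
move=> n0 /negbTE Dty; rewrite /simple_refl Dty /=; split=> [|j jn].
  by rewrite extend_small.
by rewrite extend_small /window_0C ?ifF; lia.
Qed.

Lemma simple_refl_0D ty n : (1 < n)%N -> left_D ty ->
  [/\ simple_refl ty n 0 1%N = - 2%N%:Z, simple_refl ty n 0 2%N = - 1%N%:Z &
  forall j : nat, (2 < j <= n)%N -> simple_refl ty n 0 j%:Z = j%:Z].
Proof.
move=> n0 Dty; rewrite /simple_refl Dty /=; split=> [||j jn].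
- by rewrite extend_small //; lia.
- by rewrite extend_small.
- by rewrite extend_small /window_0D ?ifF; lia.
Qed.

Lemma simple_refl_mid ty n k : (0 < k < n)%N ->
  [/\ simple_refl ty n k k = k.+1, simple_refl ty n k k.+1 = k &
  forall j : nat, (1 <= j <= n)%N -> j != k -> j != k.+1 ->
    simple_refl ty n k j%:Z = j%:Z].
Proof.
move=> kn; rewrite /simple_refl gtn_eqF ?ltn_eqF; try lia.
split=> [||j jn jk jk'].
- by rewrite extend_small /window_mid ?eqxx /=; lia.
- by rewrite extend_small ?/window_mid; [rewrite (gtn_eqF (leqnn _)) eqxx | lia].
- by rewrite extend_small /window_mid ?ifF; lia.
Qed.

Lemma simple_refl_nC ty n : (0 < n)%N -> ~~ right_D ty ->
  simple_refl ty n n n = period n - n%:Z /\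
  forall j : nat, (1 <= j < n)%N -> simple_refl ty n n j%:Z = j%:Z.
Proof.
move=> n0 /negbTE Dty; rewrite /simple_refl Dty eqxx gtn_eqF //; split=> [|j jn].
  by rewrite extend_small /window_nC ?eqxx /period /=; lia.
by rewrite extend_small /window_nC ?ifF; lia.
Qed.

Lemma simple_refl_nD ty n : (1 < n)%N -> right_D ty ->
  [/\ simple_refl ty n n n.-1 = period n - n%:Z,
      simple_refl ty n n n = period n - n.-1%:Z &
  forall j : nat, (1 <= j < n.-1)%N -> simple_refl ty n n j%:Z = j%:Z].
Proof.
move=> n0 Dty; rewrite /simple_refl Dty eqxx gtn_eqF; last by lia.
split=> [||j jn].
- by rewrite extend_small /window_nD ?eqxx /period /=; lia.
- rewrite extend_small /window_nD; [rewrite (_ : (n == n.-1) = false) ?eqxx /period /=; lia | lia].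
- by rewrite extend_small /window_nD ?ifF; lia.
Qed.

Lemma equivariant_sub n u (j : int) : equivariant n u ->
  u (period n - j) = period n - u j.
Proof. by move=> [uD uN]; rewrite addrC uD uN addrC. Qed.

Lemma min_rank_gt1 ty : (1 < min_rank ty)%N. Proof. by case: ty. Qed.

Lemma simple_reflK ty n k : (1 < n)%N -> (k <= n)%N ->
  involutive (simple_refl ty n k).
Proof.
move=> n1 kn; have e := simple_refl_equivariant ty n k.
apply: (@equivariant_ext n (simple_refl ty n k \o simple_refl ty n k) id).
- exact: equivariant_comp.
- by split.
move=> i iin /=; have [k0|k0] := posnP k.
  rewrite {k kn}k0 in e *; case: (boolP (left_D ty)) => Dty.
    have [s1 s2 s3] := simple_refl_0D n1 Dty.
    have [->|i1] := eqVneq i 1%N; first by rewrite s1 e.2 s2.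
    have [->|i2] := eqVneq i 2%N; first by rewrite s2 e.2 s1.
    by rewrite !s3; lia.
  have [s1 s3] := simple_refl_0C (ltnW n1) Dty.
  have [->|i1] := eqVneq i 1%N; first by rewrite s1 e.2 s1.
  by rewrite !s3; lia.
have [kn'|kn'] := eqVneq k n.
  rewrite {k k0 kn}kn' in e *; case: (boolP (right_D ty)) => Dty.
    have [s1 s2 s3] := simple_refl_nD n1 Dty.
    have [->|i1] := eqVneq i n.-1; first by rewrite s1 equivariant_sub // s2; lia.
    have [->|i2] := eqVneq i n; first by rewrite s2 equivariant_sub // s1; lia.
    by rewrite !s3; lia.
  have [s1 s3] := simple_refl_nC (ltnW n1) Dty.
  have [->|i1] := eqVneq i n; first by rewrite s1 equivariant_sub // s1; lia.
  by rewrite !s3; lia.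
have [|s1 s2 s3] := @simple_refl_mid ty n k; first by lia.
have [->|i1] := eqVneq i k; first by rewrite s1 s2.
have [->|i2] := eqVneq i k.+1; first by rewrite s2 s1.
by rewrite !s3.
Qed.

(* The effect of the generator [k] on the window of a function [h] such that
   [h (- i) = e1 - h i] and [h (N - i) = e2 - h i].  The boolean index tells whether
   [k = 0]; for [e1 = 1], [e2 = 0] the integer index is negative exactly when the
   reflecting hyperplane of the generator separates the point from the alcove. *)
Variant refl_spec (ty : affine_type) (e1 e2 : int) :
    bool -> int -> seq int -> seq int -> Prop :=
  | ReflMid s t x y :
      refl_spec ty e1 e2 false (x - y) (s ++ x :: y :: t) (s ++ y :: x :: t)
  | Refl0C t x of ~~ left_D ty :
      refl_spec ty e1 e2 true (1 - 2 * x) (x :: t) ((e1 - x) :: t)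
  | Refl0D t x y of left_D ty :
      refl_spec ty e1 e2 true (1 - (x + y)) [:: x, y & t] [:: e1 - y, e1 - x & t]
  | ReflnC t x of ~~ right_D ty :
      refl_spec ty e1 e2 false x (t ++ [:: x]) (t ++ [:: e2 - x])
  | ReflnD t x y of right_D ty :
      refl_spec ty e1 e2 false (x + y) (t ++ [:: x; y]) (t ++ [:: e2 - y; e2 - x]).

Definition slope (ty : affine_type) (n : nat) (h : int -> int) (k : nat) : int :=
  if k == 0%N then (if left_D ty then 1 - (h 1%N + h 2%N) else 1 - 2 * h 1%N)
  else if k == n then (if right_D ty then h n.-1%:Z + h n else h n)
  else h k - h k.+1.

Definition window (n : nat) (h : int -> int) : seq int :=
  [seq h i%:Z | i : nat <- iota 1 n].

Lemma eq_map_iota (h h' : int -> int) (m k : nat) :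
  (forall i : nat, (m <= i < m + k)%N -> h i = h' i) ->
  [seq h i%:Z | i : nat <- iota m k] = [seq h' i%:Z | i : nat <- iota m k].
Proof. by move=> E; apply/eq_in_map => i; rewrite mem_iota; apply: E. Qed.

Lemma refl_specP ty n k (h : int -> int) (e1 e2 : int) :
  (1 < n)%N -> (k <= n)%N ->
  (forall i : nat, (1 <= i <= n)%N -> h (- i%:Z) = e1 - h i) ->
  (forall i : nat, (1 <= i <= n)%N -> h (period n - i%:Z) = e2 - h i) ->
  refl_spec ty e1 e2 (k == 0%N) (slope ty n h k) (window n h)
    (window n (h \o simple_refl ty n k)).
Proof.
move=> n1 kn hN hP; rewrite /slope /window; have [k0|k0] := eqVneq k 0%N.
  rewrite {k kn}k0.
  case: (boolP (left_D ty)) => Dty.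
    have [s1 s2 s3] := simple_refl_0D n1 Dty.
    have -> : iota 1 n = [:: 1%N, 2%N & iota 3 n.-2] by move: n1; clear; case: n => [|[|n]].
    rewrite !map_cons /= s1 s2 !hN; try lia.
    rewrite (eq_map_iota (h := h \o _) (h' := h)); first exact: Refl0D.
    by move=> i iin /=; rewrite s3; lia.
  have [s1 s3] := simple_refl_0C (ltnW n1) Dty.
  have -> : iota 1 n = 1%N :: iota 2 n.-1 by move: n1; clear; case: n.
  rewrite !map_cons /= s1 !hN; try lia.
  rewrite (eq_map_iota (h := h \o _) (h' := h)); first exact: Refl0C.
  by move=> i iin /=; rewrite s3; lia.
have [kn'|kn'] := eqVneq k n.
  rewrite {k k0 kn}kn'; case: (boolP (right_D ty)) => Dty.
    have [s1 s2 s3] := simple_refl_nD n1 Dty.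
    have -> : iota 1 n = iota 1 n.-2 ++ [:: n.-1; n].
      have {1}-> : n = (n.-2 + 2)%N by lia.
      by rewrite iotaD /=; congr (_ ++ [:: _; _]); lia.
    rewrite !map_cat /= s1 s2 !hP; try lia.
    rewrite (eq_map_iota (h := h \o _) (h' := h)); first exact: ReflnD.
    by move=> i iin /=; rewrite s3; lia.
  have [s1 s3] := simple_refl_nC (ltnW n1) Dty.
  have -> : iota 1 n = iota 1 n.-1 ++ [:: n].
    have {1}-> : n = (n.-1 + 1)%N by lia.
    by rewrite iotaD /=; congr (_ ++ [:: _]); lia.
  rewrite !map_cat /= s1 !hP; try lia.
  rewrite (eq_map_iota (h := h \o _) (h' := h)); first exact: ReflnC.
  by move=> i iin /=; rewrite s3; lia.
have [|s1 s2 s3] := @simple_refl_mid ty n k; first by lia.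
have -> : iota 1 n = iota 1 k.-1 ++ [:: k, k.+1 & iota k.+2 (n - k.+1)].
  have {1}-> : n = (k.-1 + (n - k.+1).+2)%N by lia.
  by rewrite iotaD /=; congr (_ ++ [:: _, _ & iota _ _]); lia.
rewrite !map_cat /= s1 s2.
rewrite !(eq_map_iota (h := h \o _) (h' := h)); first exact: ReflMid.
  by move=> i iin /=; rewrite s3; lia.
by move=> i iin /=; rewrite s3; lia.
Qed.

(** A reflection in a wall of the alcove permutes the counts of all hyperplanes except those
    parallel to that wall, and their count changes by at most one. *)
Lemma dist_refl_spec ty b d s t : refl_spec ty 1 0 b d s t ->
  dist ty t <= dist ty s + 1 /\ (d < 0 -> dist ty t = dist ty s - 1).
Proof.
case=> [{}s {}t x y|{}t x Dty|{}t x y Dty|{}t x Dty|{}t x y Dty].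
- by rewrite (dist_swap ty s t x y); move: (dist _ _) => z; rewrite /wall; lia.
- rewrite dist_refl_head; move: (dist _ _) => z.
  by rewrite /axis_walls /wall; case: ty Dty => //= _; rewrite /offset0 /offsetn /=; lia.
- by rewrite dist_refl_head2 //; move: (dist _ _) => z; rewrite /wall; lia.
- rewrite sub0r dist_opp_last; move: (dist _ _) => z.
  by rewrite /axis_walls /wall; case: ty Dty => //= _; rewrite /offset0 /offsetn /=; lia.
- by rewrite !sub0r dist_opp_last2 //; move: (dist _ _) => z; rewrite /wall; lia.
Qed.

(** An end of shape D reflects two entries at once, so the constant [e1] or [e2] enters the sum
    twice; at an end of shape C it enters once and has to be even. *)
Lemma parity_refl_spec ty e1 e2 b d s t : refl_spec ty e1 e2 b d s t ->
  (~~ left_D ty -> ~~ odd `|e1|) -> (~~ right_D ty -> ~~ odd `|e2|) ->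
  odd `|\sum_(x <- t) x| = odd `|\sum_(x <- s) x|.
Proof.
case=> [{}s {}t x y|{}t x Dty|{}t x y Dty|{}t x Dty|{}t x y Dty] H1 H2;
  rewrite ?big_cat ?big_cons ?big_nil /=.
- by congr (odd (absz _)); ring.
- by move: (H1 Dty); move: (\sum_(j <- t) j) => z; lia.
- by move: (\sum_(j <- t) j) => z; lia.
- by move: (H2 Dty); move: (\sum_(j <- t) j) => z; lia.
- by move: (\sum_(j <- t) j) => z; lia.
Qed.

(* The weights decrease along the window, so that every descent of a generator other
   than [s_0] increases the potential. *)
Fixpoint potential (s : seq int) : int :=
  if s is x :: t then x * (size s)%:Z + potential t else 0.

Lemma potential_cat s t :
  potential (s ++ t) =
  potential s + (\sum_(x <- s) x) * (size t)%:Z + potential t.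
Proof.
elim: s => [|x s IHs] /=; first by rewrite big_nil; ring.
by rewrite IHs big_cons size_cat -addSn PoszD; ring.
Qed.

Lemma potential_refl_spec ty e1 d s t : refl_spec ty e1 0 false d s t -> d < 0 ->
  potential s < potential t.
Proof.
move=> H; move Eb : false H => b H.
case: H Eb => [{}s {}t x y|{}t x Dty|{}t x y Dty|{}t x Dty|{}t x y Dty] // _ d0.
- rewrite !potential_cat /=; move: (potential _) (potential _) (\sum_(j <- s) j).
  by move: (size t) => k a e c; lia.
- by rewrite !potential_cat /=; move: (potential _) (\sum_(j <- t) j); lia.
- by rewrite !potential_cat /=; move: (potential _) (\sum_(j <- t) j); lia.
Qed.

Lemma potential_le s (b : int) : 0 <= b -> all (fun x => x <= b) s ->
  potential s <= (size s)%:Z * (size s)%:Z * b.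
Proof.
move=> b0; elim: s => [|x s IHs] /=; first by rewrite !mul0r.
case/andP=> xb /IHs; move: (potential s) => p.
move: (size s) => k; rewrite -addn1 PoszD; nia.
Qed.

Lemma all0_refl_spec ty e1 d s t : refl_spec ty e1 0 false d s t ->
  all (fun x => x == 0) s -> all (fun x => x == 0) t.
Proof.
move=> H; move Eb : false H => b H.
case: H Eb => [{}s {}t x y|{}t x Dty|{}t x y Dty|{}t x Dty|{}t x y Dty] // _.
- by rewrite !all_cat /= => /and4P[-> -> -> ->].
- by rewrite !all_cat /= sub0r oppr_eq0.
- by rewrite !all_cat /= !sub0r !oppr_eq0 => /and4P[-> -> -> _].
Qed.

(** The inequalities of [s_1, ..., s_n] make [h] decreasing with [h n.-1 >= 0]. A left end C then
    forces zero; a left end D still admits (1, 0, ..., 0), which the parity excludes. *)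
Lemma slope_ge0 ty n (h : int -> int) : (min_rank ty <= n)%N ->
  (forall k : nat, (k <= n)%N -> 0 <= slope ty n h k) ->
  (left_D ty -> ~~ odd `|\sum_(x <- window n h) x|) ->
  forall i : nat, (1 <= i <= n)%N -> h i = 0.
Proof.
move=> nty hk hodd; have n1 := leq_trans (min_rank_gt1 ty) nty.
have mono (i d : nat) : (1 <= i)%N -> (i + d <= n)%N -> h (i + d)%N <= h i.
  move=> i1; elim: d => [|d IHd] idn; first by rewrite addn0.
  apply: le_trans (IHd _); last by lia.
  have := hk (i + d)%N; rewrite /slope gtn_eqF ?ltn_eqF; try lia.
  by rewrite addnS => /(_ _); lia.
have mono' (i j : nat) : (1 <= i <= j)%N -> (j <= n)%N -> h j <= h i.
  by move=> ij jn; have := mono i (j - i)%N; rewrite subnKC; last lia; apply; lia.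
have hn := hk n (leqnn n); rewrite /slope gtn_eqF ?eqxx in hn; last by lia.
have h0 := hk 0%N (leq0n n); rewrite /slope eqxx in h0.
have h12 := mono' 1%N 2%N isT n1.
have hnn := mono' n.-1 n ltac:(lia) ltac:(lia).
have hn1 : 0 <= h n.-1 by case: (right_D ty) hn; lia.
case: (boolP (left_D ty)) => Dty; rewrite ?Dty ?(negbTE Dty) in h0; last first.
  have h1n := mono' 1%N n.-1 ltac:(lia) ltac:(lia).
  have {}hn : 0 <= h n by case: (right_D ty) hn; lia.
  move=> i iin; have := mono' 1%N i ltac:(lia) ltac:(lia).
  by have := mono' i n ltac:(lia) ltac:(lia); lia.
have n3 : (3 <= n)%N by move: Dty nty; clear; case: ty => //=; lia.
have h2n := mono' 2%N n.-1 ltac:(lia) ltac:(lia).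
have {}hn : 0 <= h n by case: (right_D ty) hn; lia.
have tail (i : nat) : (2 <= i <= n)%N -> h i = 0.
  move=> iin; have := mono' 2%N i ltac:(lia) ltac:(lia).
  by have := mono' i n ltac:(lia) ltac:(lia); lia.
move=> i iin; have [i1|i1] := eqVneq i 1%N; last by rewrite tail; lia.
have := hodd Dty; rewrite /window.
have -> : iota 1 n = 1%N :: iota 2 n.-1 by move: n1; clear; case: n.
rewrite map_cons big_cons big1_seq ?addr0; last first.
  by move=> x /andP[_ /mapP[j]]; rewrite mem_iota => jin ->; apply: tail; lia.
by rewrite i1; lia.
Qed.

(** * Levels of the lowest beads under the generators *)

Definition affine_perm (n : nat) (u : int -> int) : Prop :=
  equivariant n u /\ injective u.

Lemma affine_perm_nmul n u (i : nat) (m : int) : affine_perm n u ->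
  (1 <= i <= n)%N -> u i <> m * period n.
Proof.
case=> eu iu iin; have um : u (m * period n) = m * period n.
  by rewrite -[X in u X]addr0 equivariant_shift // (equivariant0 eu) addr0.
rewrite -[RHS]um => /iu ; have pE : period n = 2 * n%:Z + 1 by rewrite /period; lia.
rewrite pE => E; have [m0|m0] := leP m 0; nia.
Qed.

Lemma affine_perm_comp n u v :
  affine_perm n u -> affine_perm n v -> affine_perm n (u \o v).
Proof.
by move=> [eu iu] [ev iv]; split; [apply: equivariant_comp | apply: inj_comp].
Qed.

Lemma affine_perm_refl ty n k : (1 < n)%N -> (k <= n)%N ->
  affine_perm n (simple_refl ty n k).
Proof.
move=> n1 kn; split; first exact: simple_refl_equivariant.
exact: inv_inj (simple_reflK ty n1 kn).
Qed.

(* For [u] the inverse of [w], [level n 0 u i] is the level of the lowest bead of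
   A(w) on runner [i].  With [t = n] the quotient is rounded to the nearest integer
   instead, which makes [level n n u] an odd function; its sum over 1, ..., n has the
   parity that is constrained when the right end of the graph has shape D. *)
Definition level (n t : nat) (u : int -> int) (x : int) : int :=
  - ((u x + t%:Z) %/ period n)%Z.

Lemma divz_period n (q x : int) : q * period n <= x < (q + 1) * period n ->
  (x %/ period n)%Z = q.
Proof. by apply: divz_unique; apply: period_gt0. Qed.

Lemma divz_bounds n (x : int) :
  (x %/ period n)%Z * period n <= x < ((x %/ period n)%Z + 1) * period n.
Proof.
have N0 : period n != 0 by rewrite gt_eqF ?period_gt0.
have := divz_eq x (period n); have := modz_ge0 x N0.
have := ltz_pmod x (period_gt0 n); rewrite mulrDl mul1r.
by move: (_ * _) (_ %% _)%Z => a b; lia.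
Qed.

Lemma level_sub n t u (x : int) : equivariant n u ->
  level n t u (period n - x) = level n t u (- x) - 1.
Proof.
move=> eu; rewrite /level equivariant_sub // eu.2.
have -> : period n - u x + t%:Z = 1 * period n + (- u x + t%:Z) by ring.
by rewrite divzMDl ?gt_eqF ?period_gt0 //; ring.
Qed.

(** [u] fixes the multiples of [N], so [u i] is not one of them and rounding down its opposite loses
    one more; this is the value [e1 = 1]. *)
Lemma level0_opp n u (i : nat) : affine_perm n u -> (1 <= i <= n)%N ->
  level n 0 u (- i%:Z) = 1 - level n 0 u i.
Proof.
move=> au iin; rewrite /level au.1.2 !addr0.
have := divz_bounds n (u i); have := @affine_perm_nmul n u i (u i %/ period n)%Z au iin.
move: (u i) => y; set q := (y %/ _)%Z => yq yb.
rewrite (@divz_period n (- q - 1)); first lia.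
by rewrite !mulrDl !mulNr mul1r in yb *; lia.
Qed.

(** [N] is odd, so rounding to the nearest multiple has no ties and commutes with negation. *)
Lemma levelh_opp n u x : equivariant n u ->
  level n n u (- x) = - level n n u x.
Proof.
move=> eu; rewrite /level eu.2; have := divz_bounds n (u x + n%:Z).
move: (u x) => y; set q := ((y + _) %/ _)%Z => yb.
rewrite (@divz_period n (- q)) ?opprK //.
have pE : period n = 2 * n%:Z + 1 by rewrite /period; lia.
by rewrite !mulrDl !mulNr mul1r in yb *; lia.
Qed.

Lemma level0_specP ty n k u : (1 < n)%N -> (k <= n)%N -> affine_perm n u ->
  refl_spec ty 1 0 (k == 0%N) (slope ty n (level n 0 u) k)
    (window n (level n 0 u)) (window n (level n 0 (u \o simple_refl ty n k))).
Proof.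
move=> n1 kn au; apply: (@refl_specP ty n k (level n 0 u)) => // i iin.
  exact: level0_opp.
rewrite level_sub ?level0_opp //; [lia | exact: au.1].
Qed.

Lemma levelh_specP ty n k u : (1 < n)%N -> (k <= n)%N -> affine_perm n u ->
  refl_spec ty 0 (-1) (k == 0%N) (slope ty n (level n n u) k)
    (window n (level n n u)) (window n (level n n (u \o simple_refl ty n k))).
Proof.
move=> n1 kn au; apply: (@refl_specP ty n k (level n n u)) => // i iin.
  by rewrite levelh_opp ?sub0r //; case: au.
rewrite level_sub ?levelh_opp //; [lia | exact: au.1 | exact: au.1].
Qed.

Lemma word_prod_cat ty n (s t : seq 'I_n.+1) :
  word_prod ty (s ++ t) =1 word_prod ty s \o word_prod ty t.
Proof. by elim: s => //= i s IHs x; rewrite /= IHs. Qed.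

Lemma word_prod_revK ty n (s : seq 'I_n.+1) : (1 < n)%N ->
  cancel (word_prod ty s) (word_prod ty (rev s)).
Proof.
move=> n1; elim: s => [|i s IHs] x //=.
rewrite rev_cons -cats1 word_prod_cat /= simple_reflK //.
by rewrite -ltnS.
Qed.

Lemma affine_perm_word ty n (s : seq 'I_n.+1) : (1 < n)%N ->
  affine_perm n (word_prod ty s).
Proof.
move=> n1; elim: s => [|i s IHs] /=; first by split=> //; split.
by apply: affine_perm_comp => //; apply: affine_perm_refl => //; rewrite -ltnS.
Qed.

Lemma eq_window_level n t u v : u =1 v ->
  window n (level n t u) = window n (level n t v).
Proof. by move=> uv; apply: eq_map => i; rewrite /level uv. Qed.

Lemma dist_level_id ty n : dist ty (window n (level n 0 id)) = 0.
Proof.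
have -> : window n (level n 0 id) = nseq n 0.
  apply: (@eq_from_nth _ 0); rewrite ?size_map ?size_nseq ?size_iota // => i iin.
  rewrite (nth_map 0%N) ?size_iota // nth_nseq iin nth_iota // /level addr0.
  by rewrite divz_small ?oppr0 // /period; lia.
elim: n => //= n ->; rewrite big1_seq; last first.
  by move=> y /andP[_ /nseqP[-> _]].
by rewrite !addr0 /axis_walls /wall; case: ty; rewrite /offset0 /offsetn.
Qed.

(** The reversed word spells the inverse, so that prefixing a letter to [s] composes the inverse
    with that generator on the right. *)
Lemma dist_level_word ty n (s : seq 'I_n.+1) : (1 < n)%N ->
  dist ty (window n (level n 0 (word_prod ty (rev s)))) <= (size s)%:Z.
Proof.
move=> n1; elim: s => [|i s IHs]; first by rewrite dist_level_id.
have iin : (i <= n)%N by rewrite -ltnS.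
have [h _] := dist_refl_spec (level0_specP ty n1 iin (affine_perm_word ty (rev s) n1)).
have E : word_prod ty (rev (i :: s)) =1 word_prod ty (rev s) \o simple_refl ty n i.
  by move=> x; rewrite rev_cons -cats1 word_prod_cat.
by rewrite (eq_window_level _ _ E) /=; apply: le_trans h _; lia.
Qed.

(** * Coset words and length *)

(** Without descents [u] increases on 1, ..., n, so [k <= u k]; once [u n <= n] is known, equality
    follows downwards from [n]. *)
Lemma parabolic_id ty n u : (min_rank ty <= n)%N -> affine_perm n u ->
  (forall i : nat, (1 <= i <= n)%N -> 0 < u i < period n) ->
  (right_D ty -> ~~ odd `|\sum_(x <- window n (level n n u)) x|) ->
  (forall k : nat, (1 <= k <= n)%N -> 0 <= slope ty n (fun x => period n - 2 * u x) k) ->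
  u =1 id.
Proof.
move=> nty [eu iu] u_bd uodd hk; have n1 := leq_trans (min_rank_gt1 ty) nty.
have pE : period n = 2 * n%:Z + 1 by rewrite /period; lia.
have mono (k : nat) : (1 <= k < n)%N -> u k < u k.+1.
  move=> kn; have := hk k; rewrite /slope gtn_eqF ?ltn_eqF; try lia.
  have : u k != u k.+1 by apply/eqP => /iu; lia.
  by move=> ? /(_ _); lia.
have ge_id (k : nat) : (k < n)%N -> k.+1%:Z <= u k.+1.
  elim: k => [|k IHk] kn; first by have := u_bd 1%N; lia.
  by have := mono k.+1; have := IHk; lia.
have un : u n <= n.
  have := hk n; rewrite /slope eqxx gtn_eqF; last by lia.
  case: (boolP (right_D ty)) uodd => [_ /(_ isT) uodd|_ _ /(_ _)]; last by lia.
  move=> /(_ _) un; have {}un : u n.-1 + u n <= period n by lia.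
  have mn : u n.-1 < u n by have := mono n.-1; rewrite prednK; last lia; apply; lia.
  have neq : u n.-1 + u n != period n.
    apply/eqP => E; have : u n = u (period n - n.-1%:Z).
      by rewrite equivariant_sub //; lia.
    by move=> /iu; lia.
  have un1 : u n.-1 <= n by lia.
  have mono' (i d : nat) : (1 <= i)%N -> (i + d < n)%N -> u i <= u (i + d)%N.
    move=> i1; elim: d => [|d IHd] idn; first by rewrite addn0.
    by have := mono (i + d)%N; rewrite addnS; lia.
  (* If [u n > n], the last rounded level is -1 and all others are 0, an odd sum. *)
  apply/contraT => un'; move: uodd.
  have -> : window n (level n n u) = nseq n.-1 0 ++ [:: -1].
    rewrite /window; have -> : iota 1 n = iota 1 n.-1 ++ [:: n].
      have {1}-> : n = (n.-1 + 1)%N by lia.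
      by rewrite iotaD /=; congr (_ ++ [:: _]); lia.
    rewrite map_cat /=; congr (_ ++ [:: _]).
      apply: (@eq_from_nth _ 0); rewrite ?size_map ?size_nseq ?size_iota // => i iin.
      rewrite (nth_map 0%N) ?size_iota // nth_nseq iin nth_iota // /level.
      have := mono' i.+1 (n.-1 - i.+1)%N isT; have := u_bd i.+1.
      have -> : (i.+1 + (n.-1 - i.+1) = n.-1)%N by lia.
      by move=> ? ?; rewrite add1n (@divz_period n 0) ?oppr0 // mul0r add0r mul1r; lia.
    by rewrite /level (@divz_period n 1) // mulrDl !mul1r; have := u_bd n; lia.
  rewrite big_cat big_cons big_nil big1_seq //=.
  by move=> x /nseqP[->].
have le_id (d : nat) : (d < n)%N -> u (n - d)%N <= (n - d)%N.
  elim: d => [|d IHd] dn; first by rewrite subn0.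
  have := mono (n - d.+1)%N; have := IHd.
  have -> : ((n - d.+1).+1 = n - d)%N by lia.
  lia.
apply: (@equivariant_ext n) => // i iin.
have := le_id (n - i)%N; have := ge_id i.-1; rewrite prednK; last by lia.
have -> : (n - (n - i) = i)%N by lia.
lia.
Qed.

Lemma level0_eq0 n u (i : nat) : affine_perm n u -> (1 <= i <= n)%N ->
  level n 0 u i = 0 -> 0 < u i < period n.
Proof.
move=> au iin; rewrite /level addr0 => /eqP; rewrite oppr_eq0 => /eqP q0.
have := divz_bounds n (u i); rewrite q0 mul0r add0r mul1r.
by have := @affine_perm_nmul n u i 0 au iin; rewrite mul0r; lia.
Qed.

Lemma parabolic_word ty n u : (min_rank ty <= n)%N -> affine_perm n u ->
  all (fun x => x == 0) (window n (level n 0 u)) ->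
  (right_D ty -> ~~ odd `|\sum_(x <- window n (level n n u)) x|) ->
  exists s : seq 'I_n.+1, all (fun i => i != ord0) s /\ word_prod ty s =1 u.
Proof.
move=> nty; have n1 := leq_trans (min_rank_gt1 ty) nty.
(* [N - 2 v] changes sign under [i -> N - i], which is [e2 = 0] in [refl_spec], and is less than [N]
   where [v] is positive; so the potential is bounded and its increase terminates. *)
pose h (v : int -> int) (x : int) : int := period n - 2 * v x.
pose bound : int := n%:Z * n%:Z * period n.
have [m] := ubnP `|bound - potential (window n (h u))|.
elim: m u => // m IHm u um au u0 uodd.
have u_bd (i : nat) : (1 <= i <= n)%N -> 0 < u i < period n.
  move=> iin; apply: level0_eq0 => //; apply/eqP.
  by apply: (allP u0); apply: map_f; rewrite mem_iota; lia.
have h_bd (v : int -> int) : (forall i : nat, (1 <= i <= n)%N -> 0 < v i < period n) ->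
    potential (window n (h v)) <= bound.
  move=> v_bd; have := @potential_le (window n (h v)) (period n) (ltW (period_gt0 n)).
  rewrite size_map size_iota; apply; apply/allP => x /mapP[i].
  by rewrite mem_iota => iin ->; have := v_bd i; rewrite /h; lia.
have [/existsP[k /andP[k0 kd]]|] :=
  boolP [exists k : 'I_n.+1, (k != ord0) && (slope ty n (h u) k < 0)]; last first.
  rewrite negb_exists => /forallP hk; exists [::]; split=> // x.
  rewrite /= (@parabolic_id ty n u) // => k kn.
  have kn' : (k < n.+1)%N by lia.
  have := hk (Ordinal kn'); rewrite negb_and negbK -leNgt => /orP[/eqP[]|] //.
  by move=> k0; lia.
have kn : (k <= n)%N by rewrite -ltnS.
have k0' : ((k : nat) == 0%N) = false by apply/negbTE.
have au' : affine_perm n (u \o simple_refl ty n k).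
  exact: affine_perm_comp (affine_perm_refl _ _ _).
have hspec : refl_spec ty (2 * period n) 0 (k == 0%N :> nat) (slope ty n (h u) k)
    (window n (h u)) (window n (h (u \o simple_refl ty n k))).
  apply: (@refl_specP ty n k (h u)) => // i iin; rewrite /h.
    by rewrite au.1.2; ring.
  by rewrite equivariant_sub; [ring | exact: au.1].
have := level0_specP ty n1 kn au; have := levelh_specP ty n1 kn au.
rewrite k0' in hspec * => lhs l0s.
have u0' := all0_refl_spec l0s u0.
have := potential_refl_spec hspec kd => pot.
have [||s [sall sE]] := IHm (u \o simple_refl ty n k) _ au' u0'.
- have := h_bd u u_bd; have := h_bd (u \o simple_refl ty n k).
  suff H i : (1 <= i <= n)%N -> 0 < (u \o simple_refl ty n k) i%:Z < period n.
    by move=> /(_ H); move: pot um; move: (potential _) (potential _) => a b; lia.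
  move=> iin; apply: level0_eq0 => //; apply/eqP.
  by apply: (allP u0'); apply: map_f; rewrite mem_iota; lia.
- move=> Dty; rewrite (parity_refl_spec lhs) ?Dty //; exact: uodd.
exists (rcons s k); split; first by rewrite all_rcons k0.
move=> x; rewrite -cats1 word_prod_cat /= sE /=.
by rewrite simple_reflK.
Qed.

(** Each negative slope gives a generator lowering [dist] by exactly one while both parities
    persist; the descent stops only at the zero vector, where [u] is parabolic. *)
Lemma coset_word ty n u : (min_rank ty <= n)%N -> affine_perm n u ->
  (left_D ty -> ~~ odd `|\sum_(x <- window n (level n 0 u)) x|) ->
  (right_D ty -> ~~ odd `|\sum_(x <- window n (level n n u)) x|) ->
  exists p s : seq 'I_n.+1, [/\ all (fun i => i != ord0) p,
    (size s)%:Z = dist ty (window n (level n 0 u)) &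
    word_prod ty p \o word_prod ty s =1 u].
Proof.
move=> nty; have n1 := leq_trans (min_rank_gt1 ty) nty.
have [m] := ubnP `|dist ty (window n (level n 0 u))|.
elim: m u => // m IHm u um au lodd rodd.
have [/existsP[k kd]|] :=
  boolP [exists k : 'I_n.+1, slope ty n (level n 0 u) k < 0]; last first.
  rewrite negb_exists => /forallP hk.
  have u0 : forall i : nat, (1 <= i <= n)%N -> level n 0 u i = 0.
    apply: (@slope_ge0 ty) => // k kn.
    have kn' : (k < n.+1)%N by lia.
    by have := hk (Ordinal kn'); rewrite -leNgt.
  have [|p [pall pE]] := parabolic_word nty au _ rodd.
    by apply/allP => x /mapP[i]; rewrite mem_iota => iin ->; rewrite u0 //; lia.
  exists p, [::]; split=> //.
  have -> : window n (level n 0 u) = window n (level n 0 id).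
    apply: eq_map_iota => i iin; rewrite u0; last by lia.
    by rewrite /level addr0 divz_small ?oppr0 // /period; lia.
  by rewrite dist_level_id.
have kn : (k <= n)%N by rewrite -ltnS.
have au' : affine_perm n (u \o simple_refl ty n k).
  exact: affine_perm_comp (affine_perm_refl _ _ _).
have l0s := level0_specP ty n1 kn au; have lhs := levelh_specP ty n1 kn au.
have [_ /(_ kd) dE] := dist_refl_spec l0s.
have [|||p [s [pall sE psE]]] := IHm (u \o simple_refl ty n k) _ au'.
- have := dist_ge0 ty (window n (level n 0 (u \o simple_refl ty n k))).
  by rewrite dE; move: um; move: (dist _ _) => a; lia.
- move=> Dty; rewrite (parity_refl_spec l0s) ?Dty //; exact: lodd.
- move=> Dty; rewrite (parity_refl_spec lhs) ?Dty //; exact: rodd.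
exists p, (rcons s k); split=> //.
  by rewrite size_rcons -addn1 PoszD sE dE; ring.
move=> x; rewrite /= -cats1 word_prod_cat /=.
by have := psE (simple_refl ty n k x) => /= ->; rewrite simple_reflK.
Qed.

Lemma odd_sumn_absz (s : seq int) :
  odd (sumn [seq `|x|%N | x <- s]) = odd `|\sum_(x <- s) x|.
Proof.
elim: s => [|x s IHs] /=; first by rewrite big_nil.
by rewrite big_cons oddD IHs; move: (\sum_(y <- s) y) => z; lia.
Qed.

Lemma period_inj n (q q' i j : int) :
  q * period n + i = q' * period n + j -> - period n < i - j < period n ->
  q = q' /\ i = j.
Proof.
move=> E ij; suff qq : q = q' by split=> //; move: E; rewrite qq => /addrI.
have := period_gt0 n; move: (period n) E ij => N E /andP[ij1 ij2] N0.
have E' : (q - q') * N = j - i by rewrite mulrBl; lia.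
by case: (ltgtP q q') => // qq; nia.
Qed.

(* The positions counted by [even_count] split into one arithmetic progression for
   each pair of runners [i, N - i], of length the absolute value of the level of [i]. *)
Lemma even_count_level n (e : bool) (t : nat) w u : t = (e * n)%N ->
  affine_perm n w -> cancel w u -> cancel u w ->
  even_count [pred i : int | (i <= t%:Z) && (t%:Z + 1 <= w i)] ->
  ~~ odd `|\sum_(x <- window n (level n t u)) x|.
Proof.
move=> tE [ew iw] wK uK [s [s_uniq sE s_even]].
have pE : period n = 2 * n%:Z + 1 by rewrite /period; lia.
have te : e = false /\ t = 0%N \/ e = true /\ t = n.
  by rewrite tE; case: (e); [right; rewrite mul1n | left].
have eu : equivariant n u.
  split=> i; apply: iw; first by rewrite ew.1 !uK.
  by rewrite ew.2 !uK.
pose lev (i : nat) : int := level n t u i.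
have levE (i : nat) : - lev i * period n <= u i + t%:Z < (- lev i + 1) * period n.
  by rewrite /lev /level opprK; apply: divz_bounds.
(* On runner [i] the images [k * N + i] exceed [t] from [k = e] on, whereas on runner [N - i] the
   images [k * N + (N - i)] exceed it from [k = 0] on in both cases. *)
pose g (i m : nat) : int :=
  if 0 < lev i then (m + e)%N%:Z * period n + u i else m%:Z * period n + (period n - u i).
have wg i m : w (g i m) =
    if 0 < lev i then (m + e)%N%:Z * period n + i%:Z else m%:Z * period n + (period n - i%:Z).
  rewrite /g; case: ifP => _; first by rewrite equivariant_shift // uK.
  by rewrite equivariant_shift // (equivariant_sub _ ew) uK.
have s_perm : perm_eq s [seq g i m | i <- iota 1 n, m <- iota 0 `|lev i|].
  apply: uniq_perm => //.
    apply: allpairs_uniq_dep => [|i _|]; rewrite ?iota_uniq // .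
    move=> _ _ /allpairsPdep[i [m [iin min ->]]] /allpairsPdep[i' [m' [iin' min' ->]]] /=.
    move: iin min iin' min'; rewrite !mem_iota => iin min iin' min'.
    move=> /(congr1 w); rewrite !wg; case: ifP => li; case: ifP => li'.
    - case/period_inj => [|mm ii]; first by lia.
      by have [-> ->] : i = i' /\ m = m' by lia.
    - by case/period_inj; lia.
    - by case/period_inj; lia.
    - case/period_inj => [|mm ii]; first by lia.
      by have [-> ->] : i = i' /\ m = m' by lia.
  move=> y; rewrite sE inE; apply/idP/allpairsPdep.
    case/andP; set x := w y => yt xt; have yE : y = u x by rewrite wK.
    have y0 : y <> 0 by move=> y0; move: xt; rewrite /x y0 (equivariant0 ew); lia.
    have [m [xE|[i iin [xE|xE]]]] := residueP n x.
    - move: yt xt; rewrite yE xE -[m * _]addr0 equivariant_shift // (equivariant0 eu).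
      by lia.
    - have {}yE : y = m * period n + u i by rewrite yE xE equivariant_shift.
      have em : e%:Z <= m by move: xt; rewrite xE; case: te => -[-> ->]; nia.
      have lm : m - e%:Z < lev i.
        by have := levE i; move: yt em y0; rewrite yE; case: te => -[-> ->]; nia.
      exists i, `|m - e%:Z|%N; rewrite !mem_iota; split; [lia | lia|].
      by rewrite /g ifT; [rewrite yE; congr (_ * _ + _) | ]; lia.
    - have {}yE : y = m * period n - u i by rewrite yE xE equivariant_shift // eu.2.
      have em : 1 <= m by move: xt; rewrite xE; nia.
      have lm : lev i <= - m by have := levE i; move: yt; rewrite yE; nia.
      exists i, `|m - 1|%N; rewrite !mem_iota; split; [lia | lia|].
      rewrite /g ifF; last by lia.
      have -> : `|m - 1|%N%:Z = m - 1 by lia.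
      by rewrite yE; ring.
  move=> [i [m [iin min ->]]]; rewrite wg /g.
  move: iin min (levE i); rewrite !mem_iota => iin.
  by case: te => -[-> ->]; case: ifP; nia.
move: s_even; rewrite (perm_size s_perm) size_allpairs_dep.
rewrite -odd_sumn_absz /window -map_comp.
by under eq_map do rewrite size_iota.
Qed.

Lemma coxeter_lengthP ty n w k : has_word ty n w k ->
  has_word ty n w (coxeter_length ty n w) /\ (coxeter_length ty n w <= k)%N.
Proof.
move=> wk; rewrite /coxeter_length; case: pselect => [e|[]]; last by exists k.
by case: ex_minnP => m wm mmin; split=> //; apply: mmin.
Qed.

Lemma cancel_equivariant n w u : injective w ->
  equivariant n w -> cancel u w -> equivariant n u.
Proof.
move=> iw ew uK; split=> i; apply: iw; first by rewrite ew.1 !uK.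
by rewrite ew.2 !uK.
Qed.

(** Minimality bounds the length of [w] by that of [w] times the parabolic factor, hence by [dist];
    conversely a shortest word of [w], reversed, spells [u] and has at least [dist] letters. *)
Lemma coxeter_length_dist ty n w u : (min_rank ty <= n)%N ->
  min_coset_rep ty n w -> cancel w u -> cancel u w ->
  (coxeter_length ty n w)%:Z = dist ty (window n (level n 0 u)).
Proof.
move=> nty [[[wbij wD wN] wl wr] wmin] wK uK; have n1 := leq_trans (min_rank_gt1 ty) nty.
have aw : affine_perm n w by split; [split | apply: bij_inj].
have au : affine_perm n u.
  by split; [apply: cancel_equivariant uK; [exact: aw.2 | exact: aw.1] | apply: can_inj uK].
have [||p [s [pall sE psE]]] := coset_word nty au.
- by move=> /wl; apply: (even_count_level (e := false)).
- by move=> /wr; apply: (even_count_level (e := true)); rewrite ?mul1n.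
have wE : w \o word_prod ty p =1 word_prod ty (rev s).
  move=> x; apply: (can_inj uK); rewrite /= wK -psE /=.
  have := word_prod_revK ty (rev s) n1; rewrite revK => ->.
  by [].
have w1 : has_word ty n (w \o word_prod ty p) (size s).
  by apply/asboolP; exists (rev s); rewrite size_rev; split=> // x; rewrite -wE.
have pw : in_parabolic ty n (word_prod ty p) by exists p.
(* Some word for [w] has to exist, so that its length is not the default value 0. *)
have w2 : has_word ty n w (size (rev s ++ rev p)).
  apply/asboolP; exists (rev s ++ rev p); split=> // x.
  rewrite word_prod_cat /= -wE /=; congr w.
  by have := word_prod_revK ty (rev p) n1; rewrite revK => ->.
have [/asboolP[s' [s'len s'E]] _] := coxeter_lengthP w2.
have [_ lw1] := coxeter_lengthP w1.
apply/eqP; rewrite eq_le; apply/andP; split.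
  by rewrite -sE; have := wmin _ pw; lia.
have := dist_level_word ty s' n1; rewrite s'len.
suff E : word_prod ty (rev s') =1 u by rewrite (eq_window_level _ _ E).
by move=> x; rewrite -[x in LHS]uK -s'E word_prod_revK.
Qed.

(** * The abacus and the boundary of the core *)

Lemma leq_nth_count (s : seq nat) (i j : nat) : sorted geq s -> (0 < j)%N ->
  (j <= nth 0 s i)%N = (i < count (leq j) s)%N.
Proof.
move=> + j0; elim: s i => [|x s IHs] i /= s_sorted; first by rewrite nth_nil; lia.
have xs : all (fun y => y <= x)%N s by rewrite (@order_path_min _ geq) // => ? ? ?; lia.
have [jx|jx] := leqP j x.
  by case: i => [|i] /=; rewrite ?jx // IHs ?(path_sorted s_sorted) // add1n ltnS.
have -> : count (leq j) s = 0%N.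
  by apply/eqP; rewrite -leqn0 leqNgt -has_count; apply/hasPn => y /(allP xs); lia.
case: i => [|i] /=; first by rewrite leqNgt jx.
have [is_|is_] := ltnP i (size s); last by rewrite nth_default //; lia.
by have := allP xs _ (mem_nth 0%N is_) => /=; lia.
Qed.

Lemma leq_part_conj la (i j : nat) : is_partition la -> (0 < i)%N -> (0 < j)%N ->
  (j <= part la i)%N = (i <= conj_part la j)%N.
Proof. by move=> /andP[la_s _] i0 j0; rewrite /part leq_nth_count // prednK. Qed.

Lemma leq_part la (q q' : nat) : is_partition la -> (0 < q <= q')%N ->
  (part la q' <= part la q)%N.
Proof.
move=> la_p qq; have [->//|p0] := posnP (part la q').
rewrite leq_part_conj //; last by lia.
apply: (@leq_trans q'); first by lia.
by rewrite -leq_part_conj //; lia.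
Qed.

Lemma ltr_north_diag la (q q' : nat) : is_partition la -> (0 < q < q')%N ->
  north_diag la q' < north_diag la q.
Proof. by move=> la_p qq; have := @leq_part la q q' la_p; rewrite /north_diag; lia. Qed.

Lemma north_diag_le la (q q' : nat) : is_partition la -> (0 < q)%N -> (0 < q')%N ->
  (north_diag la q' <= north_diag la q) = (q <= q')%N.
Proof.
move=> la_p q0 q0'; have [qq|qq] := leqP q q'.
  by move: qq; rewrite leq_eqVlt => /orP[/eqP->|qq]; rewrite ?lexx //; apply/ltW/ltr_north_diag; lia.
by apply/negbTE; rewrite -ltNge; apply: ltr_north_diag; lia.
Qed.

Lemma north_diag_inj la (q q' : nat) : is_partition la -> (0 < q)%N -> (0 < q')%N ->
  north_diag la q = north_diag la q' -> q = q'.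
Proof.
move=> la_p q0 q0' E; have := @north_diag_le la q q' la_p q0 q0'.
by have := @north_diag_le la q' q la_p q0' q0; rewrite E lexx; lia.
Qed.

Lemma north_not_east la k : is_partition la -> north_step la k -> ~ east_step la k.
Proof.
move=> la_p [i i0 <-] [j j0]; rewrite /north_diag /east_diag.
by have := leq_part_conj la_p i0 j0; lia.
Qed.

Lemma east_north la k : self_conjugate la ->
  east_step la k <-> north_step la (-1 - k).
Proof.
move=> la_c; split=> -[j j0]; rewrite /east_diag /north_diag => E; exists j => //.
  by rewrite /north_diag la_c //; lia.
by rewrite /east_diag -la_c //; lia.
Qed.

Lemma level0_sub n u x : affine_perm n u -> runner n x ->
  level n 0 u (period n - x) = - level n 0 u x.
Proof.
move=> au /andP[x1 x2]; have pE : period n = 2 * n%:Z + 1 by rewrite /period; lia.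
have [xn|xn] := leP x n.
  have -> : x = `|x|%N by lia.
  by rewrite level_sub ?level0_opp //; [lia | lia | exact: au.1].
set y := `|(period n - x)%R|%N; have -> : x = period n - y%:Z by lia.
have -> : period n - (period n - y%:Z) = y%:Z by ring.
by rewrite level_sub ?level0_opp //; [lia | lia | exact: au.1].
Qed.

Lemma abacus_level n w u a (m i : int) : affine_perm n w -> cancel w u ->
  equivariant n u -> abacus_of n w a -> runner n i ->
  a (label n m i) = (m <= level n 0 u i).
Proof.
move=> [ew iw] wK eu [a_flush a_low] ri.
have [j rj [m0 [wj abead m0max]]] := a_low i ri.
have -> : level n 0 u i = m0.
  have : j = m0 * period n + u i by rewrite -equivariant_shift // -/(label n m0 i) -wj wK.
  have pE : period n = 2 * n%:Z + 1 by rewrite /period; lia.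
  move: rj; rewrite /runner => /andP[j1 j2] jE; rewrite /level addr0.
  rewrite (@divz_period n (- m0)) ?opprK // mulrDl mulNr mul1r; lia.
apply/idP/idP => [/m0max //|mm].
by apply: (a_flush i m m0) => //; rewrite -wj.
Qed.

Definition bead n u (p : int) : bool :=
  (p %/ (2 * n)%N%:Z)%Z <= level n 0 u (1 + (p %% (2 * n)%N%:Z)%Z).

Lemma divz_modz_unique (d q r x : int) : x = q * d + r -> 0 <= r < d ->
  (x %/ d)%Z = q /\ (x %% d)%Z = r.
Proof.
move=> -> rd; rewrite modzMDl modz_small // divzMDl; last by apply/eqP; lia.
by rewrite divz_small ?addr0 //; lia.
Qed.

Lemma bead_opp n u p : (0 < n)%N -> affine_perm n u ->
  bead n u (4 * n%:Z - 1 - p) = ~~ bead n u p.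
Proof.
move=> n0 au; rewrite /bead; set M := (2 * n)%N%:Z.
have M0 : M != 0 by rewrite /M; lia.
have := divz_eq p M; have := modz_ge0 p M0; have := ltz_mod p M0.
move: (p %/ M)%Z (p %% M)%Z => q r rM r0 pE.
have [||-> ->] := @divz_modz_unique M (1 - q) (M - 1 - r) (4 * n%:Z - 1 - p).
- by rewrite pE /M; lia.
- by lia.
have -> : 1 + (M - 1 - r) = period n - (1 + r) by rewrite /M /period; lia.
rewrite level0_sub //; last by rewrite /runner -/M; lia.
by move: (level _ _ _ _) => z; lia.
Qed.

Lemma north_step_bead n la w u k : (0 < n)%N -> affine_perm n w -> cancel w u ->
  affine_perm n u -> is_partition la -> self_conjugate la -> core_of n w la ->
  north_step la k <-> bead n u ((2 * n)%N%:Z + k).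
Proof.
move=> n0 aw wK au la_p la_c [a a_w [c hc]]; set M := (2 * n)%N%:Z.
have M0 : M != 0 by rewrite /M; lia.
have aE p : a (entry n p) = bead n u p.
  rewrite /entry /bead (abacus_level _ aw wK au.1 a_w) //.
  have := modz_ge0 p M0; have := ltz_mod p M0; rewrite /runner -/M.
  by move: (p %% M)%Z => r; lia.
have bN j : bead n u (c + j) <-> north_step la j.
  have := hc j; rewrite aE; case: ifP => // _ ej; split=> // nj.
  by have := north_not_east la_p nj ej.
have bopp j : bead n u (c - 1 - j) = ~~ bead n u (c + j).
  have -> : c - 1 - j = c + (-1 - j) by ring.
  apply/idP/idP => [/bN /(east_north _ la_c) ej|].
    by apply/negP => /bN /north_not_east; apply.
  have := hc j; rewrite aE; case: ifP => // _ /(east_north _ la_c) nj _.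
  exact/bN.
have shift e : bead n u (e + (4 * n%:Z - 2 * c)) = bead n u e.
  have -> : e + (4 * n%:Z - 2 * c) = 4 * n%:Z - 1 - (c - 1 - (e - c)) by ring.
  by rewrite bead_opp // bopp negbK; congr bead; ring.
(* Both the abacus and the boundary are antisymmetric, so any other choice of [c]
   would make the abacus periodic. *)
suff cE : c = M by rewrite -bN cE.
pose P := 4 * n%:Z - 2 * c.
have shiftn (t : nat) e : bead n u (e + t%:Z * P) = bead n u e.
  elim: t => [|t IHt]; first by rewrite mul0r addr0.
  by rewrite -IHt -[RHS]shift -/P; congr bead; rewrite -addn1 PoszD; ring.
have beadM q : bead n u (q * M) = (q <= level n 0 u 1).
  by rewrite /bead -/M mulzK // modzMl.
(* Shifting [2 * n] times by [P] moves runner 1 by [P] whole levels; its lowest bead allows this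
   only for [P = 0]. *)
have := shiftn (2 * n)%N (level n 0 u 1 * M); have := shiftn (2 * n)%N ((level n 0 u 1 - P) * M).
rewrite -/M; have E x : x * M + M * P = (x + P) * M by ring.
by rewrite !E !beadM /P /M; lia.
Qed.

(** Diagonal 0 is entry [2 * n], the first one of level 1. Hence [m * (2 * n) + (i - 1)] is on
    runner [i] at level [m + 1], but [m * (2 * n) - i] is on runner [N - i] at level [m]. *)
Definition runner_beads n (a : nat -> int) (la : seq nat) : Prop :=
  forall (i : nat) (m : int), (1 <= i <= n)%N ->
    (north_step la (m * (2 * n)%N%:Z + (i%:Z - 1)) <-> m < a i) /\
    (north_step la (m * (2 * n)%N%:Z - i%:Z) <-> m < 1 - a i).

Lemma runner_beads_level n la w u : (0 < n)%N -> affine_perm n w -> cancel w u ->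
  affine_perm n u -> is_partition la -> self_conjugate la -> core_of n w la ->
  runner_beads n (fun i => level n 0 u i) la.
Proof.
move=> n0 aw wK au la_p la_c la_w i m iin.
have B := north_step_bead _ n0 aw wK au la_p la_c la_w; rewrite !B /bead.
set M := (2 * n)%N%:Z.
have [||-> ->] := @divz_modz_unique M (m + 1) (i%:Z - 1) (M + (m * M + (i%:Z - 1))).
- by ring.
- by rewrite /M; lia.
have [||-> ->] := @divz_modz_unique M m (M - i%:Z) (M + (m * M - i%:Z)).
- by ring.
- by rewrite /M; lia.
have -> : 1 + (i%:Z - 1) = i by ring.
have -> : 1 + (M - i%:Z) = period n - i%:Z by rewrite /M /period; lia.
rewrite level0_sub //; last by rewrite /runner; lia.
by move: (level _ _ _ _) => z; split; lia.
Qed.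

(** The least [m] with [k <= m * (2 * n) + r]. *)
Definition ceil_quot n (k r : int) : int := - ((r - k) %/ (2 * n)%N%:Z)%Z.

Lemma ceil_quotE n (m r r0 : int) : - n%:Z <= r < n%:Z -> - n%:Z <= r0 < n%:Z ->
  ceil_quot n (m * (2 * n)%N%:Z + r0) r = m + (r < r0)%R%:Z /\
  ceil_quot n (m * (2 * n)%N%:Z + r0 + 1) r = m + (r <= r0)%R%:Z.
Proof.
move=> rn r0n; rewrite /ceil_quot; set M := (2 * n)%N%:Z.
have M0 : 0 < M by rewrite /M; lia.
split.
  rewrite (@divz_unique M (- m - (r < r0)%R%:Z)) //; first by ring.
  by case: (ltP r r0) => rr /=; rewrite !(mulrBl, mulrDl, mulNr, mul1r, mul0r) /M; lia.
rewrite (@divz_unique M (- m - (r <= r0)%R%:Z)) //; first by ring.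
by case: (leP r r0) => rr /=; rewrite !(mulrBl, mulrDl, mulNr, mul1r, mul0r) /M; lia.
Qed.

(* The number of beads on the runners [i] and [N - i] at diagonals at least [k]. *)
Definition class_beads n (a : nat -> int) (i : nat) (k : int) : int :=
  Num.max 0 (a i - ceil_quot n k (i%:Z - 1)) +
  Num.max 0 (1 - a i - ceil_quot n k (- i%:Z)).

Definition beads_from n (a : nat -> int) (k : int) : int :=
  \sum_(1 <= i < n.+1) class_beads n a i k.

Lemma sum_nat_indicator n (i0 : nat) (c : int) : (1 <= i0 <= n)%N ->
  \sum_(1 <= i < n.+1) (if i == i0 then c else 0) = c.
Proof.
move=> iin; rewrite -big_mkcond big_nat1_eq ifT //; lia.
Qed.

Lemma beads_from_step n a (i0 : nat) (m : int) : (1 <= i0 <= n)%N ->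
  beads_from n a (m * (2 * n)%N%:Z + (i0%:Z - 1)) =
    beads_from n a (m * (2 * n)%N%:Z + (i0%:Z - 1) + 1) + (m < a i0)%R%:Z /\
  beads_from n a (m * (2 * n)%N%:Z - i0%:Z) =
    beads_from n a (m * (2 * n)%N%:Z - i0%:Z + 1) + (m < 1 - a i0)%R%:Z.
Proof.
move=> iin; split.
  rewrite -(sum_nat_indicator (m < a i0)%R%:Z iin) /beads_from -big_split.
  apply: eq_big_nat => i iin' /=; rewrite /class_beads.
  have [| |-> ->] := @ceil_quotE n m (i%:Z - 1) (i0%:Z - 1); try lia.
  have [| |-> ->] := @ceil_quotE n m (- i%:Z) (i0%:Z - 1); try lia.
  by case: eqP => [->|ii]; lia.
rewrite -(sum_nat_indicator (m < 1 - a i0)%R%:Z iin) /beads_from -big_split.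
apply: eq_big_nat => i iin' /=; rewrite /class_beads.
have [| |-> ->] := @ceil_quotE n m (i%:Z - 1) (- i0%:Z); try lia.
have [| |-> ->] := @ceil_quotE n m (- i%:Z) (- i0%:Z); try lia.
by case: eqP => [->|ii]; lia.
Qed.

Lemma diag_class n (k : int) : (0 < n)%N -> exists (i : nat) (m : int),
  (1 <= i <= n)%N /\
  (k = m * (2 * n)%N%:Z + (i%:Z - 1) \/ k = m * (2 * n)%N%:Z - i%:Z).
Proof.
move=> n0; set M := (2 * n)%N%:Z; have M0 : M != 0 by rewrite /M; lia.
have := divz_eq k M; have := modz_ge0 k M0; have := ltz_mod k M0.
move: (k %/ M)%Z (k %% M)%Z => q r rM r0 kE.
have [rn|rn] := ltP r n%:Z.
  by exists `|(r + 1)%R|%N, q; split; [lia | left; rewrite kE; lia].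
exists `|(M - r)%R|%N, (q + 1); split; first by rewrite /M; lia.
by right; rewrite kE mulrDl mul1r; lia.
Qed.

Lemma beads_from_north n a la k : (0 < n)%N -> runner_beads n a la ->
  (north_step la k -> beads_from n a k = beads_from n a (k + 1) + 1) /\
  (~ north_step la k -> beads_from n a k = beads_from n a (k + 1)).
Proof.
move=> n0 hB; have [i [m [iin [->|->]]]] := diag_class k n0;
  have [B1 B2] := hB i m iin; have [E1 E2] := beads_from_step a m iin.
  by rewrite E1 B1; case: ltP => am; split=> // _; rewrite ?addr0.
by rewrite E2 B2; case: ltP => am; split=> // _; rewrite ?addr0.
Qed.

Lemma beads_from_gap n a la (k : int) (d : nat) : (0 < n)%N -> runner_beads n a la ->
  (forall j, k <= j < k + d%:Z -> ~ north_step la j) ->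
  beads_from n a k = beads_from n a (k + d%:Z).
Proof.
move=> n0 hB; elim: d => [|d IHd] hd; first by rewrite addr0.
rewrite IHd => [|j jd]; last by apply: hd; lia.
have [_ ->] := beads_from_north (k + d%:Z) n0 hB; last by apply: hd; lia.
by congr beads_from; lia.
Qed.

(** * Counting beads and gaps *)

Lemma ceil_quot_ge n (k r : int) (m : int) : (0 < n)%N ->
  r <= k - m * (2 * n)%N%:Z -> m <= ceil_quot n k r.
Proof.
move=> n0 rk; rewrite /ceil_quot; set M := (2 * n)%N%:Z in rk *.
have M0 : 0 < M by rewrite /M; lia.
have : ((r - k) %/ M)%Z < - m + 1 by rewrite ltz_divLR // mulrDl mulNr mul1r; lia.
by move: (_ %/ _)%Z => q; lia.
Qed.

Lemma beads_from_large n a (k0 : int) : (0 < n)%N ->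
  exists d : nat, beads_from n a (k0 + d%:Z) = 0.
Proof.
(* [S] bounds all levels in absolute value, so no bead lies at or beyond diagonal
   [S.+1 * (2 * n)]. *)
move=> n0; pose S := (\max_(i < n.+1) `|a i|%N)%N.
exists (`|k0| + S.+1 * (2 * n))%N; rewrite /beads_from big1_seq // => i.
rewrite mem_index_iota => /andP[_ iin]; rewrite /class_beads.
have aS : (`|a i| <= S)%N.
  have iin' : (i < n.+1)%N by lia.
  exact: (leq_bigmax (F := fun j : 'I_n.+1 => `|a j|%N) (Ordinal iin')).
have E : k0 + (`|k0| + S.+1 * (2 * n))%N%:Z >= S.+1%:Z * (2 * n)%N%:Z by lia.
have := @ceil_quot_ge n (k0 + (`|k0| + S.+1 * (2 * n))%N%:Z) (i%:Z - 1) S%:Z n0.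
have := @ceil_quot_ge n (k0 + (`|k0| + S.+1 * (2 * n))%N%:Z) (- i%:Z) S.+1%:Z n0.
move=> /(_ _) c1 /(_ _) c2.
have {}c1 : S.+1%:Z <= ceil_quot n (k0 + (`|k0| + S.+1 * (2 * n))%N%:Z) (- i%:Z).
  by apply: c1; lia.
have {}c2 : S%:Z <= ceil_quot n (k0 + (`|k0| + S.+1 * (2 * n))%N%:Z) (i%:Z - 1).
  by apply: c2; rewrite -addn1 PoszD mulrDl mul1r in E; lia.
move: c1 c2; move: (ceil_quot _ _ _) (ceil_quot _ _ _) => c d; lia.
Qed.

(** Going up the boundary from row [q.+1], one meets exactly the north steps of the [q] rows above
    it. Empty rows below the diagram count as rows here. *)
Lemma beads_from_rank n a la (q : nat) : (0 < n)%N -> is_partition la ->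
  runner_beads n a la ->
  beads_from n a (north_diag la q.+1 + 1) = q%:Z.
Proof.
move=> n0 la_p hB; elim: q => [|q IHq].
  have [d dE] := beads_from_large a (north_diag la 1 + 1) n0.
  apply: etrans dE; apply: (beads_from_gap n0 hB) => j jd [q q0 qE].
  by have := @north_diag_le la 1 q la_p isT q0; lia.
have dd : north_diag la q.+2 < north_diag la q.+1 by apply: ltr_north_diag; lia.
pose d := `|(north_diag la q.+1 - north_diag la q.+2 - 1)%R|%N.
rewrite (@beads_from_gap n a la _ d n0 hB); last first.
  move=> j jd [p p0 pE].
  have := @north_diag_le la p q.+1 la_p p0 isT.
  have := @north_diag_le la q.+2 p la_p isT p0; rewrite pE /d in jd *.
  by move: dd jd; clear; move: (north_diag _ _) (north_diag _ _); lia.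
have -> : north_diag la q.+2 + 1 + d%:Z = north_diag la q.+1.
  by rewrite /d; move: dd; clear; move: (north_diag _ _) (north_diag _ _); lia.
have nq : north_step la (north_diag la q.+1) by exists q.+1.
have [/(_ nq) -> _] := beads_from_north (north_diag la q.+1) n0 hB.
by rewrite IHq -addn1 PoszD.
Qed.

Lemma beads_from_diag n a la (q : nat) : (0 < n)%N -> is_partition la ->
  runner_beads n a la -> (0 < q)%N -> beads_from n a (north_diag la q) = q%:Z.
Proof.
move=> n0 la_p hB; case: q => // q _.
have nq : north_step la (north_diag la q.+1) by exists q.+1.
have [/(_ nq) -> _] := beads_from_north (north_diag la q.+1) n0 hB.
by rewrite (beads_from_rank _ n0 la_p hB) -addn1 PoszD.
Qed.

Lemma beads_from_anti n a la (k : int) (d : nat) : (0 < n)%N ->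
  runner_beads n a la -> beads_from n a (k + d%:Z) <= beads_from n a k.
Proof.
move=> n0 hB; elim: d => [|d IHd]; first by rewrite addr0.
apply: le_trans IHd.
have -> : k + d.+1%:Z = k + d%:Z + 1 by lia.
have [h1 h2] := beads_from_north (k + d%:Z) n0 hB.
by have [/h1 ->|/h2 ->] := pselect (north_step la (k + d%:Z)); lia.
Qed.

Lemma leq_beads_from n a la (k : int) (q : nat) : (0 < n)%N -> is_partition la ->
  runner_beads n a la -> (0 < q)%N ->
  (q%:Z <= beads_from n a k) = (k <= north_diag la q).
Proof.
move=> n0 la_p hB q0; have [kq|kq] := leP k (north_diag la q).
  rewrite -(beads_from_diag n0 la_p hB q0).
  have := beads_from_anti k `|(north_diag la q - k)%R|%N n0 hB.
  by have -> : k + `|(north_diag la q - k)%R|%N%:Z = north_diag la q by lia.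
apply/negbTE; rewrite -ltNge.
have := beads_from_anti (north_diag la q + 1) `|(k - (north_diag la q + 1))%R|%N n0 hB.
have -> : north_diag la q + 1 + `|(k - (north_diag la q + 1))%R|%N%:Z = k by lia.
case: q q0 kq => // q _ _; rewrite (beads_from_rank _ n0 la_p hB).
by move: (beads_from _ _ _) => z; lia.
Qed.

(** Beyond diagonal [n] both runners of a pair start at [m = 1], leaving [a i - 1] beads on one or
    [- a i] on the other. *)
Lemma beads_from_n n a : (0 < n)%N ->
  beads_from n a n%:Z = \sum_(1 <= i < n.+1) wall (a i).
Proof.
move=> n0; apply: eq_big_nat => i iin; rewrite /class_beads.
have nE : n%:Z = 1 * (2 * n)%N%:Z + - n%:Z by lia.
have [| |c1 _] := @ceil_quotE n 1 (i%:Z - 1) (- n%:Z); try lia.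
have [| |c2 _] := @ceil_quotE n 1 (- i%:Z) (- n%:Z); try lia.
by rewrite nE c1 c2 /wall; lia.
Qed.

Lemma part_gt0_size la (q : nat) : (0 < q)%N -> (0 < part la q)%N -> (q <= size la)%N.
Proof. by case: q => // q _; rewrite /part /= ltnNge; apply: contraR => ?; rewrite nth_default //; lia. Qed.

(** By self-conjugacy the hook at [(q, q)] has length [2 * (part la q - q) + 1], which exceeds
    [2 * n] exactly when the diagonal of row [q] is at least [n]. *)
Lemma num_long_diagE n a la : (0 < n)%N -> is_partition la -> self_conjugate la ->
  runner_beads n a la -> (num_long_diag n la)%:Z = beads_from n a n%:Z.
Proof.
move=> n0 la_p la_c hB; rewrite /num_long_diag.
have b0 : 0 <= beads_from n a n%:Z.
  by rewrite beads_from_n // sumr_ge0 // => i _; rewrite /wall; lia.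
have E (q : nat) : (0 < q)%N -> in_diagram la q q && (2 * n < hook_length la q q)%N =
    (q <= `|beads_from n a n%:Z|)%N.
  move=> q0; have := leq_beads_from n%:Z n0 la_p hB q0.
  rewrite /in_diagram /hook_length -la_c // q0 /north_diag.
  by move: b0; move: (beads_from _ _ _) => z; lia.
have -> : count (fun i => in_diagram la i i && (2 * n < hook_length la i i)%N)
    (iota 1 (size la)) = count (fun i => i <= `|beads_from n a n%:Z|)%N (iota 1 (size la)).
  by apply: eq_in_count => i; rewrite mem_iota => iin; apply: E; lia.
have d_size : (`|beads_from n a n%:Z| <= size la)%N.
  have [->//|d0] := posnP `|beads_from n a n%:Z|.
  apply: part_gt0_size => //; have := E _ d0; rewrite leqnn /in_diagram; lia.
move: b0 d_size; move: (beads_from _ _ _) => z z0 zs.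
have -> : (size la = `|z| + (size la - `|z|))%N by lia.
rewrite iotaD count_cat.
have -> : count (fun i => i <= `|z|)%N (iota 1 `|z|) = `|z|%N.
  rewrite -[RHS](size_iota 1) -[RHS]count_predT; apply: eq_in_count => i.
  by rewrite mem_iota => iin /=; lia.
have -> : count (fun i => i <= `|z|)%N (iota (1 + `|z|) (size la - `|z|)) = 0%N.
  rewrite -[RHS](count_pred0 (iota (1 + `|z|) (size la - `|z|))); apply: eq_in_count => i.
  by rewrite mem_iota => iin /=; lia.
lia.
Qed.

(* The diagonals of the rows r(i) and R(i). *)
Definition low_bead (a : nat -> int) (i : nat) : int :=
  if 0 < a i then i%:Z - 1 else - i%:Z.

Definition top_bead n (a : nat -> int) (i : nat) : int :=
  wall (a i) * (2 * n)%N%:Z + low_bead a i.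

(* The number of gaps on the runners [j] and [N - j] between the beads of the rows
   r(i) and R(i). *)
Definition gaps (a : nat -> int) (i j : nat) : int :=
  2 * wall (a i) +
  (Num.max 0 (a j - (wall (a i) + (j%:Z - 1 < low_bead a i)%R%:Z)) +
   Num.max 0 (1 - a j - (wall (a i) + (- j%:Z < low_bead a i)%R%:Z))) -
  (Num.max 0 (a j - (j%:Z - 1 < low_bead a i)%R%:Z) +
   Num.max 0 (1 - a j - (- j%:Z < low_bead a i)%R%:Z)).

(** Between the two rows the runner of the beads has no gap and its mirror image no bead. *)
Lemma gaps_diag a i : (0 < i)%N -> gaps a i i = wall (a i).
Proof. by rewrite /gaps /low_bead /wall; case: ifP; lia. Qed.

Lemma gaps_swap a i j : (0 < i < j)%N ->
  gaps a i j + gaps a j i = pair_walls (a i) (a j) - (0 < a j)%R%:Z.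
Proof.
have wall_gt0 x : 0 < x -> wall x = x - 1 by rewrite /wall; lia.
have wall_le0 x : x <= 0 -> wall x = - x by rewrite /wall; lia.
move=> ij; rewrite /gaps /low_bead.
have cmp : (((j%:Z - 1 < i%:Z - 1) = false) * ((j%:Z - 1 < - i%:Z) = false) *
    ((- j%:Z < i%:Z - 1) = true) * ((- j%:Z < - i%:Z) = true)) *
   (((i%:Z - 1 < j%:Z - 1) = true) * ((i%:Z - 1 < - j%:Z) = false) *
    ((- i%:Z < j%:Z - 1) = true) * ((- i%:Z < - j%:Z) = false)).
  by do !split; lia.
case: (ltP 0 (a i)) => ai; case: (ltP 0 (a j)) => aj;
  rewrite ?(wall_gt0 _ ai) ?(wall_gt0 _ aj) ?(wall_le0 _ ai) ?(wall_le0 _ aj);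
  rewrite ?cmp /pair_walls /wall /=; lia.
Qed.

Lemma gaps_eq0 a i j : wall (a i) = 0 -> gaps a i j = 0.
Proof. by rewrite /gaps => ->; rewrite !add0r; lia. Qed.

Lemma low_bead_bounds n a (i : nat) : (1 <= i <= n)%N -> - n%:Z <= low_bead a i < n%:Z.
Proof. by rewrite /low_bead; case: ifP; lia. Qed.

(** A row index is a bead count, so a part is its diagonal plus the number of beads from there on.
    The two diagonals differ by [wall (a i)] periods, each with two entries per class [j]. *)
Lemma part_sub_gaps n a la (i q q' : nat) : (0 < n)%N -> is_partition la ->
  runner_beads n a la -> (1 <= i <= n)%N -> (0 < q)%N -> (0 < q')%N ->
  north_diag la q = top_bead n a i -> north_diag la q' = low_bead a i ->
  (part la q)%:Z - (part la q')%:Z = \sum_(1 <= j < n.+1) gaps a i j.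
Proof.
move=> n0 la_p hB iin q0 q0' qE qE'.
have -> : (part la q)%:Z = top_bead n a i + beads_from n a (top_bead n a i).
  by rewrite -qE (beads_from_diag n0 la_p hB q0) /north_diag; lia.
have -> : (part la q')%:Z = low_bead a i + beads_from n a (low_bead a i).
  by rewrite -qE' (beads_from_diag n0 la_p hB q0') /north_diag; lia.
have lb := low_bead_bounds a iin.
have -> : top_bead n a i + beads_from n a (top_bead n a i) -
   (low_bead a i + beads_from n a (low_bead a i)) =
   \sum_(1 <= j < n.+1) (2 * wall (a i)) + beads_from n a (top_bead n a i) -
     beads_from n a (low_bead a i).
  rewrite sumr_const_nat subn1 /= /top_bead -mulr_natr natz PoszM.
  by ring.
rewrite /beads_from -big_split -sumrB; apply: eq_big_nat => j jn /=.
rewrite /class_beads /gaps.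
have [| |c1 _] := @ceil_quotE n (wall (a i)) (j%:Z - 1) (low_bead a i); try lia.
have [| |c2 _] := @ceil_quotE n (wall (a i)) (- j%:Z) (low_bead a i); try lia.
have [| |c3 _] := @ceil_quotE n 0 (j%:Z - 1) (low_bead a i); try lia.
have [| |c4 _] := @ceil_quotE n 0 (- j%:Z) (low_bead a i); try lia.
by rewrite /top_bead c1 c2; rewrite mul0r !add0r in c3 c4; rewrite c3 c4.
Qed.

(** The new last coordinate meets [n] earlier ones; the deficit in [gaps_swap] then amounts to [n]
    if it is positive, and [1 + offset0 ty] from [axis_walls] completes the coefficient
    [n.+1 + offset0 ty]. *)
Lemma sum_gaps_dist ty n a :
  \sum_(1 <= i < n.+1) \sum_(1 <= j < n.+1) gaps a i j
  + (1 + offset0 ty + offsetn ty) * \sum_(1 <= i < n.+1) wall (a i)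
  + \sum_(1 <= i < n.+1) (0 < a i)%R%:Z * (i%:Z + offset0 ty)
  = dist ty [seq a i | i <- iota 1 n].
Proof.
elim: n => [|n IHn]; first by rewrite !big_geq //= mulr0.
have -> : iota 1 n.+1 = iota 1 n ++ [:: n.+1] by rewrite -[in LHS](addn1 n) iotaD add1n.
rewrite map_cat dist_cat -IHn /= big_nil big_map.
have -> : \sum_(i <- iota 1 n) \sum_(y <- [:: a n.+1]) pair_walls (a i) y =
    \sum_(1 <= i < n.+1) pair_walls (a i) (a n.+1).
  rewrite /index_iota subn1 /=; apply: eq_bigr => i _.
  by rewrite big_cons big_nil addr0.
have -> : \sum_(1 <= i < n.+1) pair_walls (a i) (a n.+1) =
    \sum_(1 <= i < n.+1) gaps a i n.+1 + \sum_(1 <= i < n.+1) gaps a n.+1 i +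
    n%:Z * (0 < a n.+1)%R%:Z.
  rewrite -big_split /=.
  have -> : n%:Z * (0 < a n.+1)%R%:Z = \sum_(1 <= i < n.+1) (0 < a n.+1)%R%:Z.
    by rewrite sumr_const_nat subn1 /= -mulr_natl natz.
  rewrite -big_split; apply: eq_big_nat => i iin /=; rewrite gaps_swap; last by lia.
  by rewrite subrK.
rewrite !(@big_nat_recr _ _ _ n.+1) //=.
under eq_bigr do rewrite (@big_nat_recr _ _ _ n.+1) //=.
rewrite big_split /= gaps_diag // /axis_walls intS.
ring.
Qed.

(** Rows after the first [d] end on diagonals below [n]; the nonnegative ones among these are the
    [i - 1] with [a i > 0]. *)
Lemma diag_sum_runners ty n a la : (0 < n)%N -> is_partition la -> self_conjugate la ->
  runner_beads n a la ->
  diag_sum ty la (num_long_diag n la).+1 =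
  \sum_(1 <= i < n.+1) (0 < a i)%R%:Z * (i%:Z + offset0 ty).
Proof.
move=> n0 la_p la_c hB.
have dE := num_long_diagE n0 la_p la_c hB; set d := num_long_diag n la in dE *.
pose psi (k : int) : int := Num.max 0 (k + 1 + offset0 ty).
(* This bound kills the terms on negative diagonals; the next one makes [psi] linear on the
   others. *)
have x0 : offset0 ty <= 0 by rewrite /offset0; case: left_D.
have x1 : -1 <= offset0 ty by rewrite /offset0; case: left_D.
transitivity (\sum_(k <- [seq north_diag la q | q <- index_iota d.+1 (size la).+1] | 0 <= k)
   psi k).
  rewrite big_map big_mkcond /diag_sum; apply: eq_bigr => q _.
  by rewrite /psi /north_diag; case: ifP => // /negbT; rewrite -ltNge; lia.
transitivity (\sum_(k <- [seq i%:Z - 1 | i <- index_iota 1 n.+1 & 0 < a i]) psi k).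
  rewrite -big_filter; apply: perm_big; apply: uniq_perm.
  - rewrite filter_uniq // map_inj_in_uniq ?iota_uniq // => q q'.
    rewrite !mem_index_iota => qq qq'; apply: north_diag_inj => //; lia.
  - rewrite map_inj_uniq ?filter_uniq ?iota_uniq // => i j; lia.
  move=> k; rewrite mem_filter; apply/andP/mapP => [[k0 /mapP[q qin kE]]|[i]].
    move: qin; rewrite mem_index_iota => qin.
    have q0 : (0 < q)%N by lia.
    have kn : k < n.
      by rewrite kE ltNge -(leq_beads_from _ n0 la_p hB q0) -dE; lia.
    exists `|(k + 1)%R|%N; last by lia.
    rewrite mem_filter mem_index_iota; apply/andP; split; last by lia.
    have [|<- _] := hB `|(k + 1)%R|%N 0; first by lia.
    by exists q => //; rewrite -kE; lia.
  rewrite mem_filter mem_index_iota => /andP[ai iin] kE.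
  have [|/iffRL /(_ ai) [q q0]] := hB i 0; first by lia.
  rewrite mul0r add0r -kE => qE _.
  split; first by rewrite kE; lia.
  apply/mapP; exists q => //; rewrite mem_index_iota; apply/andP; split.
    have := leq_beads_from n%:Z n0 la_p hB q0; rewrite qE -dE.
    have -> : (n%:Z <= k) = false by lia.
    lia.
  rewrite ltnS part_gt0_size //.
  by move: qE; rewrite /north_diag; lia.
rewrite big_map big_filter big_mkcond; apply: eq_big_nat => i iin.
by rewrite /psi; case: ltP => ai /=; lia.
Qed.

(** * The rows R(i) and r(i) *)

Lemma top_bead_north n a la (i : nat) : (1 <= i <= n)%N ->
  runner_beads n a la -> north_step la (top_bead n a i).
Proof.
move=> iin hB; have [h1 h2] := hB i (wall (a i)) iin.
rewrite /top_bead /low_bead; case: ltP => ai; [apply/h1 | apply/h2]; rewrite /wall; lia.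
Qed.

Lemma low_bead_north n a la (i : nat) : (1 <= i <= n)%N ->
  runner_beads n a la -> north_step la (low_bead a i).
Proof.
move=> iin hB; have := hB i 0 iin; rewrite mul0r !add0r => -[h1 h2].
by rewrite /low_bead; case: ltP => ai; [apply/h1 | apply/h2]; lia.
Qed.

Lemma row_labelE n la q : row_label n la q = 1 + (north_diag la q %% (2 * n)%N%:Z)%Z.
Proof. by []. Qed.

(** [top_bead] is the last bead of both runners of the pair, so every other row with such a label
    lies below and is no longer. With more than [n] rows, a north step on a diagonal at least [-n]
    belongs to a nonempty row. *)
Lemma long_row_exists n a la (i q : nat) : (1 <= i <= n)%N -> is_partition la ->
  runner_beads n a la -> (n < size la)%N -> (0 < q)%N -> north_diag la q = top_bead n a i ->
  is_long_row n la i q.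
Proof.
move=> iin la_p hB n_size q0 qE; set M := (2 * n)%N%:Z.
have rowP p : (0 < p)%N -> - n%:Z <= north_diag la p -> is_row la p.
  move=> p0; rewrite /is_row p0 /north_diag; case: leqP => // ps.
  by rewrite /part nth_default; lia.
have w0 : 0 <= wall (a i) by rewrite /wall; lia.
have lb := low_bead_bounds a iin.
have M0 : 0 <= wall (a i) * M by rewrite mulr_ge0.
split.
  split; first by apply: rowP => //; rewrite qE /top_bead -/M; lia.
  rewrite row_labelE qE /top_bead -/M modzMDl /low_bead; case: ifP => _.
    by left; rewrite modz_small /M; lia.
  right; have [||_ ->] := @divz_modz_unique M (-1) (M - i%:Z) (- i%:Z); rewrite /M /period; lia.
move=> q' [/andP[q0' _] q'l].
have qq : (q <= q')%N.
  rewrite -(north_diag_le la_p q0 q0') qE.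
  have nq' : north_step la (north_diag la q') by exists q'.
  have := divz_eq (north_diag la q') M; move: q'l nq'; rewrite row_labelE -/M.
  move: (north_diag la q') (_ %/ _)%Z (_ %% _)%Z => k c rk rk_label nk kE.
  have [h1 _] := hB i c iin; have [_ h2] := hB i (c + 1) iin.
  move: h1 h2; rewrite -/M /top_bead -/M /low_bead => h1 h2.
  have Mn : M = 2 * n%:Z by rewrite /M; lia.
  have Mge0 : 0 <= M by rewrite Mn; lia.
  case: rk_label => r1.
    have {}kE : k = c * M + (i%:Z - 1) by lia.
    move: h1; rewrite -kE => /iffLR /(_ nk).
    rewrite kE -lezD1 => /(ler_wpM2r Mge0); rewrite mulrDl mul1r.
    case: (ltP 0 (a i)) => ai ca.
      have -> : wall (a i) = a i - 1 by rewrite /wall; lia.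
      by rewrite mulrBl mul1r; lia.
    have -> : wall (a i) = - a i by rewrite /wall; lia.
    by have := mulr_le0_ge0 ai Mge0; rewrite mulNr; lia.
  (* Label [N - i] means remainder [2 * n - i], that is, offset [- i] in the next period. *)
  have {}kE : k = (c + 1) * M - i%:Z by rewrite mulrDl mul1r; move: r1; rewrite /period; lia.
  move: h2; rewrite -kE => /iffLR /(_ nk).
  rewrite kE => ca.
  have {}ca : c + 1 <= - a i by lia.
  move: ca => /(ler_wpM2r Mge0); rewrite !mulrDl mul1r mulNr.
  case: (ltP 0 (a i)) => ai ca.
    have -> : wall (a i) = a i - 1 by rewrite /wall; lia.
    have := ler_wpM2r Mge0 (_ : 1 <= a i); rewrite mul1r mulrBl mul1r; lia.
  have -> : wall (a i) = - a i by rewrite /wall; lia.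
  by rewrite mulNr; lia.
by split=> [|_] //; apply: leq_part => //; lia.
Qed.

(** Two diagonals in [[-n, n)] that agree modulo [2 * n] are equal. *)
Lemma center_row_unique n a la (i q r : nat) : (1 <= i <= n)%N -> is_partition la ->
  (n < size la)%N -> (0 < r)%N ->
  north_diag la q = top_bead n a i -> north_diag la r = low_bead a i ->
  unique (is_center_row n la q) r.
Proof.
move=> iin la_p n_size r0 qE rE; set M := (2 * n)%N%:Z.
have lb := low_bead_bounds a iin.
have lE : (north_diag la q %% M)%Z = (north_diag la r %% M)%Z.
  by rewrite qE rE /top_bead -/M modzMDl.
split.
  split; [|by rewrite rE|by rewrite !row_labelE -/M lE].
  rewrite /is_row r0 /=; move: rE; rewrite /north_diag; case: leqP => // ps.
  by rewrite /part nth_default; lia.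
move=> r' [/andP[r0' _] lb']; rewrite !row_labelE -/M => l'.
apply: (north_diag_inj la_p) => //; rewrite rE.
have := divz_eq (north_diag la r') M; have := divz_eq (north_diag la r) M.
have -> : (north_diag la r' %% M)%Z = (north_diag la r %% M)%Z by rewrite -lE; lia.
have Mn : M = 2 * n%:Z by rewrite /M; lia.
rewrite rE; move: lb lb'; move: (low_bead a i) (north_diag la r') (_ %/ _)%Z (_ %/ _)%Z (_ %% _)%Z.
move=> x y c' c s; clear -Mn => xn yn xE yE.
have E : (c - c') * M = x - y by rewrite mulrBl; lia.
by case: (ltgtP c c') => cc; [nia | nia | rewrite xE yE cc].
Qed.

Theorem proposition8p3 (ty : affine_type) (n : nat) (hn : (min_rank ty <= n)%N)
    (la : seq nat) (w : int -> int)
    (hla : symmetric_core n la)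
    (hw : min_coset_rep ty n w)
    (hC : core_of n w la) :
  (all (fun x => (x <= n)%N) la ->
     (coxeter_length ty n w)%:Z = diag_sum ty la 1)
  /\
  (~~ all (fun x => (x <= n)%N) la ->
     exists R r : nat -> nat,
       (forall i : nat, (1 <= i <= n)%N ->
          is_long_row n la i (R i) /\ unique (is_center_row n la (R i)) (r i))
       /\
       (coxeter_length ty n w)%:Z =
         \sum_(1 <= i < n.+1) ((part la (R i))%:Z - (part la (r i))%:Z)
         + (1 + offset0 ty + offsetn ty) * (num_long_diag n la)%:Z
         + diag_sum ty la (num_long_diag n la).+1).
Proof.
have n1 := leq_trans (min_rank_gt1 ty) hn; have n0 : (0 < n)%N by lia.
have [la_p la_c _] := hla.
have [[[[u wK uK] wD wN] _ _] _] := hw.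
have aw : affine_perm n w by split; [split | apply: can_inj wK].
have au : affine_perm n u.
  by split; [apply: cancel_equivariant uK; [exact: aw.2 | exact: aw.1] | apply: can_inj uK].
pose a (i : nat) : int := level n 0 u i.
have hB : runner_beads n a la := runner_beads_level n0 aw wK au la_p la_c hC.
rewrite (coxeter_length_dist hn hw wK uK) -(sum_gaps_dist ty n a).
have dE := num_long_diagE n0 la_p la_c hB.
rewrite -beads_from_n // -dE -(diag_sum_runners ty n0 la_p la_c hB).
split=> [la_n|la_n].
  (* A row of length at most [n] ends on a diagonal below [n], but a positive wall count would push
     the top bead to [n] or beyond. *)
  have walls0 (i : nat) : (1 <= i <= n)%N -> wall (a i) = 0.
    move=> iin; have [q q0] := top_bead_north iin hB.
    rewrite /north_diag /top_bead => qE.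
    have pn : (part la q <= n)%N.
      have [qs|qs] := ltnP q.-1 (size la); last by rewrite /part nth_default.
      by apply: (allP la_n); apply: mem_nth.
    have := low_bead_bounds a iin; have : 0 <= wall (a i) by rewrite /wall; lia.
    by move: qE; nia.
  have d0 : num_long_diag n la = 0%N.
    suff : (num_long_diag n la)%:Z = 0 by lia.
    rewrite dE beads_from_n // big1_seq // => i.
    by rewrite mem_index_iota => /andP[_ iin]; apply: walls0; lia.
  rewrite d0 mulr0 addr0 big1_seq ?add0r // => i.
  rewrite mem_index_iota => /andP[_ iin]; rewrite big1_seq // => j _.
  by apply: gaps_eq0; apply: walls0; lia.
(* A part above [n] makes the first row, hence by symmetry the first column, longer than [n]. *)
have n_size : (n < size la)%N.
  have [x xla xn] := allPn la_n.
  have x1 : (x <= part la 1)%N.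
    rewrite -(nth_index 0%N xla) -[index x la]/((index x la).+1.-1).
    by apply: (@leq_part la 1).
  have := count_size (leq 1) la; rewrite -/(conj_part la 1) -la_c //; lia.
have /choice[R hR] : forall i : nat, exists q : nat, (1 <= i <= n)%N ->
    (0 < q)%N /\ north_diag la q = top_bead n a i.
  move=> i; have [iin|_] := boolP (1 <= i <= n)%N; last by exists 0%N.
  by have [q q0 qE] := top_bead_north iin hB; exists q.
have /choice[r hr] : forall i : nat, exists q : nat, (1 <= i <= n)%N ->
    (0 < q)%N /\ north_diag la q = low_bead a i.
  move=> i; have [iin|_] := boolP (1 <= i <= n)%N; last by exists 0%N.
  by have [q q0 qE] := low_bead_north iin hB; exists q.
exists R, r; split.
  move=> i iin; have [R0 RE] := hR i iin; have [r0 rE] := hr i iin.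
  by split; [apply: long_row_exists RE | apply: center_row_unique RE rE].
congr (_ + _ + _); apply: eq_big_nat => i iin.
have iin' : (1 <= i <= n)%N by lia.
have [R0 RE] := hR i iin'; have [r0 rE] := hr i iin'.
by rewrite (part_sub_gaps n0 la_p hB iin' R0 r0 RE rE).
Qed.
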